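(* Let $T>0$, $0\le\alpha<2$ and $\beta,\mu\in\mathbb R$ with $\Delta=(1-\alpha-\beta)^2-4\mu\ge0$. Then there exists $C_T>0$ such that $$\int_0^T\left|\mathbb B_\nu^*\mathbb T(t)(w_0,w_1)\right|^2dt\le C_T\|(w_0,w_1)\|_X^2\qquad\text{for all }(w_0,w_1)\in X_1 .$$
   Context: Parameters: $\kappa_\alpha=\frac{2-\alpha}{2}$, $\Delta=(1-\alpha-\beta)^2-4\mu$, $\nu=\frac{\sqrt\Delta}{2\kappa_\alpha}$, $\sigma=\frac{1-\alpha-\beta}{2}$. Spectral data: $J_\nu$ is the Bessel function of the first kind, $0<j_{\nu,1}<j_{\nu,2}<\dots$ its positive zeros. For $k\ge1$ put $$\Phi_k(x)=\frac{(2\kappa_\alpha)^{1/2}}{|J_\nu'(j_{\nu,k})|}x^\sigma J_\nu(j_{\nu,k}x^{\kappa_\alpha}),\qquad \lambda_k=\kappa_\alpha^2 j_{\nu,k}^2 .$$ $(\Phi_k)_{k\ge1}$ is an orthonormal basis of the complex Hilbert space $L^2_\beta(0,1)=L^2((0,1);x^\beta dx)$. Fractional spaces: for $s\in\mathbb R$, $\mathcal H^s$ is the Hilbert space of (formal, if $s<0$) series $u=\sum_{k\ge1}a_k\Phi_k$, $a_k\in\mathbb C$, with $\|u\|_{\mathcal H^s}^2=\sum_k\lambda_k^s|a_k|^2<\infty$. The operator $\mathcal A:\mathcal H^{s+2}\to\mathcal H^s$ acts by $\mathcal A\sum a_k\Phi_k=\sum\lambda_k a_k\Phi_k$. State spaces: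 $X=\mathcal H^{\nu+1/2}\times\mathcal H^{\nu-1/2}$ and $X_1=\mathcal H^{\nu+3/2}\times\mathcal H^{\nu+1/2}$ with the product Hilbert norms. The operator $\mathbf A(w_0,w_1)=(w_1,-\mathcal A w_0)$ with domain $X_1$ is skew-adjoint on $X$ and generates a unitary group $\mathbb T(t)$, $t\in\mathbb R$, which preserves $X_1$; explicitly, if $w_0=\sum a_k\Phi_k$, $w_1=\sum c_k\Phi_k$ and $\gamma_k=\lambda_k^{1/2}$, then the first component of $\mathbb T(t)(w_0,w_1)$ is $\sum_k(a_k\cos\gamma_kt+\gamma_k^{-1}c_k\sin\gamma_kt)\Phi_k$ and the second is its time derivative. Observation operator $\mathbb B_\nu^*:X_1\to\mathbb C$ (a bounded linear functional): $\mathbb B_\nu^*(w_0,w_1)=\lim_{x\to0^+}x^{-\sigma}w_0(x)$ if $\nu=0$, and $\mathbb B_\nu^*(w_0,w_1)=\sqrt\Delta\lim_{x\to0^+}x^{-\sigma-\sqrt\Delta/2}w_0(x)$ if $\nu>0$, where $w_0$ is identified with its continuous representative on $(0,1)$. *)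

(* Defs.v *)
From HB Require Import structures.
From mathcomp Require Import all_boot all_order all_algebra.
From mathcomp Require Import complex.
From mathcomp Require Import all_classical all_reals all_analysis.
Set Implicit Arguments.
Unset Strict Implicit.
Unset Printing Implicit Defensive.
Import Order.TTheory GRing.Theory Num.Theory.
Import numFieldNormedType.Exports.
Import ComplexField.Normc.
Local Open Scope classical_set_scope.
Local Open Scope complex_scope.
Local Open Scope ring_scope.

(* [normc z : R] is the modulus of z : R[i]; R[i]^o is R[i] with its norm
   topology.  Sequences indexed mathematically by k >= 1 are indexed from 0:
   index k stands for k + 1. *)

Section Bessel.
Variable R : realType.

(* Euler's integral, meaningful for x > 0, the only case used. *)
Definition Gamma (x : R) : R :=
  \int[lebesgue_measure]_(t in `]0, +oo[) (t `^ (x - 1) * expR (- t)).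

Definition besselJ_term (nu x : R) (m : nat) : R :=
  (-1) ^+ m / (m`!%:R * Gamma (m%:R + nu + 1)) * (x / 2) `^ (2 * m%:R + nu).

(* Used only for order nu >= 0 and x >= 0. *)
Definition besselJ (nu x : R) : R := limn (series (besselJ_term nu x)).

(* j is the increasing enumeration of all positive zeros of J_nu
   (j k = j_{nu, k+1}); there is exactly one such j when nu >= 0. *)
Definition bessel_zeros (nu : R) (j : nat -> R) : Prop :=
  {homo j : m n / (m < n)%N >-> m < n} /\
  (forall x : R, (0 < x /\ besselJ nu x = 0) <-> exists k, x = j k).

End Bessel.

Section Coefficients.
Variable R : realType.
Variables alpha beta mu : R.

Definition kappa : R := (2 - alpha) / 2.
Definition Delta : R := (1 - alpha - beta) ^+ 2 - 4 * mu.
Definition nu : R := Num.sqrt Delta / (2 * kappa).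
Definition sigma : R := (1 - alpha - beta) / 2.

End Coefficients.

Section Spectral.
Variable R : realType.
Variables (alpha beta mu : R) (j : nat -> R).

Local Notation kappa := (kappa alpha).
Local Notation Delta := (Delta alpha beta mu).
Local Notation nu := (nu alpha beta mu).
Local Notation sigma := (sigma alpha beta).

Definition Phi (k : nat) (x : R) : R :=
  Num.sqrt (2 * kappa) / `|derive1 (besselJ nu) (j k)| *
  (x `^ sigma * besselJ nu (j k * x `^ kappa)).

Definition lambda (k : nat) : R := kappa ^+ 2 * j k ^+ 2.
Definition gamma (k : nat) : R := Num.sqrt (lambda k).

(* A (possibly formal) series sum_k a_k Phi_k is represented by its complex
   coefficient sequence a.  The squared H^s norm lives in \bar R, so that H^s
   is the set of sequences where it is finite. *)
Definition sqnormH (s : R) (a : nat -> R[i]) : \bar R :=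
  (\sum_(0 <= k <oo) (lambda k `^ s * normc (a k) ^+ 2)%:E)%E.

Definition Hs (s : R) : set (nat -> R[i]) := [set a | (sqnormH s a < +oo)%E].

Definition state := ((nat -> R[i]) * (nat -> R[i]))%type.

Definition X1 : set state := Hs (nu + 3 / 2) `*` Hs (nu + 1 / 2).

Definition sqnormX (w : state) : \bar R :=
  (sqnormH (nu + 1 / 2)%R w.1 + sqnormH (nu - 1 / 2)%R w.2)%E.

Definition T_group (t : R) (w : state) : state :=
  (fun k => w.1 k * (cos (gamma k * t))%:C
            + ((gamma k)^-1 * sin (gamma k * t))%:C * w.2 k,
   fun k => - (gamma k * sin (gamma k * t))%:C * w.1 k
            + w.2 k * (cos (gamma k * t))%:C).

(* f is continuous on (0,1) and the partial sums of sum_k a_k Phi_k converge to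
   f in L^2((0,1); x^beta dx). *)
Definition is_continuous_rep (a : nat -> R[i]) (f : R -> R[i]) : Prop :=
  (forall x : R, 0 < x < 1 -> {for x, continuous (f : R -> R[i]^o)}) /\
  (fun n : nat => (\int[lebesgue_measure]_(x in `]0%R, 1%R[)
     (normc (f x - \sum_(k < n) a k * (Phi k x)%:C) ^+ 2 * x `^ beta)%:E)%E)
    @ \oo --> 0%E.

(* Two representatives of a agree on (0,1), so the choice made by xget is
   irrelevant there. *)
Definition continuous_rep (a : nat -> R[i]) : R -> R[i] :=
  xget (fun=> 0) [set f | is_continuous_rep a f].

Definition obs (w : state) : R[i] :=
  let w0 := continuous_rep w.1 in
  if nu == 0 then lim (((x `^ (- sigma))%:C * w0 x : R[i]^o) @[x --> 0^'+])
  else (Num.sqrt Delta)%:C *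
       lim (((x `^ (- sigma - Num.sqrt Delta / 2))%:C * w0 x : R[i]^o) @[x --> 0^'+]).

End Spectral.

(* Main.v *)
Require Import Defs.
From HB Require Import structures.
From mathcomp Require Import all_boot all_order all_algebra.
From mathcomp Require Import complex.
From mathcomp Require Import all_classical all_reals all_analysis.
From mathcomp Require Import measurable_realfun ring lra.
Import Order.TTheory GRing.Theory Num.Theory.
Import numFieldNormedType.Exports.
Import ComplexField.Normc.
Set Implicit Arguments.
Unset Strict Implicit.
Unset Printing Implicit Defensive.
Local Open Scope classical_set_scope.
Local Open Scope ring_scope.

(** Write J_nu x = c x^nu g(x): the function g is an entire function of x^2
with g(0) = 1, and it solves g'' = - g - (2 nu + 1) / z g'.  In terms of g,
  Phi_k x = weight_k x^(sigma + kappa nu) g (j_k x^kappa),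
with weight_k = sqrt (2 kappa) / |g'(j_k)|.  So the observation picks the value
at 0 of g in every mode, and observing the state at time t gives, up to a
constant factor, the nonharmonic Fourier series
  sum_k weight_k (a_k cos (gamma_k t) + c_k / gamma_k sin (gamma_k t))
of frequencies gamma_k = kappa j_k.  The theorem is then a consequence of two
facts on the zeros j_k, both read off monotone energies of the differential
equation.

First, the zeros are at distance at least 1 from each other
([bessel_ode_gap]): the energy g'^2 + g^2 decreases, so after a critical point c
the slope never exceeds |g(c)|.  Hence the frequencies have a uniform gap, and
Ingham's direct inequality ([ingham_upper], [ingham_series]) bounds the L^2 norm
on [0, T] of the series by the l^2 norm of its coefficients.  It is proved by
integrating the square of the series against the weight S^2 - t^2, whose cosine
transform decays quadratically.

Second, weight_k^2 <= C lambda_k^(nu + 1/2) ([weight_le]).  This is the lower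
bound j_k^(2 nu + 1) g'(j_k)^2 >= c ([bessel_ode_derive_ge]), which comes from
an energy of the Liouville form u'' + q u = 0 of the equation, with
u = z^(nu + 1/2) g.  With it the l^2 norm of the coefficients is controlled by
the norm of X.

It remains to justify the formula for the observation.  For data in X_1 the
coefficients are absolutely summable ([X1_majorant_cvg]).  Since |g| <= 1 on the
half-line, the series of the weight_k a_k g (j_k x^kappa) converges uniformly,
so it is continuous and can be evaluated at 0 term by term; x^(sigma + kappa nu)
times this sum is the only continuous representative of the state
([continuous_repE]), which gives [obsE].  That J_nu is c x^nu g uses the
functional equation of the Gamma integral ([Gamma_recurrence]). *)

(** * Derivation rules and finite sums *)

Section derive_rules.
Variable R : realType.
Implicit Types (f g : R -> R) (x : R).

(** Pointwise forms of the derivation rules: composed as terms, they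
differentiate explicit expressions. *)
Lemma is_derive_add f g x df dg : is_derive x 1 f df -> is_derive x 1 g dg ->
  is_derive x 1 (fun y => f y + g y) (df + dg).
Proof. exact: is_deriveD. Qed.

Lemma is_derive_mul f g x df dg : is_derive x 1 f df -> is_derive x 1 g dg ->
  is_derive x 1 (fun y => f y * g y) (df * g x + f x * dg).
Proof.
move=> Df Dg; apply: is_derive_eq (is_deriveM Df Dg) _.
by rewrite /GRing.scale /=; ring.
Qed.

Lemma is_derive_const (c x : R) : is_derive x 1 (fun=> c) 0.
Proof. exact: is_derive_cst. Qed.

Lemma is_derive_var (x : R) : is_derive x 1 (fun y => y) 1.
Proof. exact: is_derive_id. Qed.

Lemma is_derive_inv f x df : f x != 0 -> is_derive x 1 f df ->
  is_derive x 1 (fun y => (f y)^-1) (- df / f x ^+ 2).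
Proof.
move=> fx0 [Df <-]; split; first exact: derivableV.
by rewrite deriveV// /GRing.scale /=; field.
Qed.

Lemma is_derive_powR (p x : R) : 0 < x ->
  is_derive x 1 (fun y => y `^ p) (p / x * x `^ p).
Proof.
move=> x0; apply: is_derive_eq; first exact: is_derive1_powR.
have x1 : x `^ 1 = x by rewrite powRr1 ?ltW.
rewrite powRB ?(gt_eqF x0) ?implybT// x1.
by field; rewrite gt_eqF.
Qed.

Lemma is_derive_continuous f x df : is_derive x 1 f df -> {for x, continuous f}.
Proof.
by move=> [Df _]; apply: differentiable_continuous; exact/derivable1_diffP.
Qed.

Lemma MVT_is_derive (f df : R -> R) (a b : R) : a <= b ->
  (forall x, a <= x <= b -> {for x, continuous f}) ->
  (forall x, a < x < b -> is_derive x 1 f (df x)) ->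
  exists2 c, a <= c <= b & f b - f a = df c * (b - a).
Proof.
move=> ab cf Df.
have Df' x : x \in `]a, b[%R -> is_derive x 1 f (df x).
  by rewrite in_itv/=; exact: Df.
have [|c cab ->] := MVT_segment ab Df'.
  by apply: continuous_in_subspaceT => x; rewrite inE/= in_itv/=; exact: cf.
by exists c; rewrite // -in_itv.
Qed.

Lemma le_of_derive_ge0 (f df : R -> R) (a b : R) : a <= b ->
  (forall x, a <= x <= b -> {for x, continuous f}) ->
  (forall x, a < x < b -> is_derive x 1 f (df x)) ->
  (forall x, a <= x <= b -> 0 <= df x) ->
  f a <= f b.
Proof.
move=> ab cf Df df0; rewrite -subr_ge0.
have [c cab ->] := MVT_is_derive ab cf Df.
by rewrite mulr_ge0 ?subr_ge0// df0.
Qed.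

Lemma cvg_sum_ord T (F : set_system T) {FF : Filter F} n (h : nat -> T -> R)
    (l : nat -> R) : (forall k, h k t @[t --> F] --> l k) ->
  \sum_(k < n) h k t @[t --> F] --> \sum_(k < n) l k.
Proof.
move=> hl; elim: n => [|n IH].
  have -> : (fun t => \sum_(k < 0) h k t) = fun=> 0.
    by apply/funext => t; rewrite big_ord0.
  by rewrite big_ord0; exact: cvg_cst.
have -> : (fun t => \sum_(k < n.+1) h k t) =
    (fun t => \sum_(k < n) h k t + h n t).
  by apply/funext => t; rewrite big_ord_recr.
by rewrite big_ord_recr; exact: cvgD IH (hl n).
Qed.

End derive_rules.

(** * Energies of the Bessel equation *)

Section bessel_ode.
Variable R : realType.
Implicit Types (e z a b : R) (g dg : R -> R).

(** The solution regular at 0; for e = 2 nu + 1 it is a multiple of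
z^(- nu) J_nu z. *)
Definition bessel_ode e g dg :=
  [/\ forall z, is_derive z 1 g (dg z),
      forall z, 0 < z -> is_derive z 1 dg (- g z - e / z * dg z),
      forall z, {for z, continuous dg},
      g 0 = 1 & dg 0 = 0].

Lemma is_derive_energy e g dg z : bessel_ode e g dg -> 0 < z ->
  is_derive z 1 (fun y => dg y * dg y + g y * g y) (- (2 * e / z * dg z ^+ 2)).
Proof.
move=> [Dg Ddg _ _ _] z0.
apply: is_derive_eq (is_derive_add (is_derive_mul (Ddg z z0) (Ddg z z0))
  (is_derive_mul (Dg z) (Dg z))) _.
by field; rewrite gt_eqF.
Qed.

Lemma continuous_energy e g dg z : bessel_ode e g dg ->
  {for z, continuous (fun y => dg y * dg y + g y * g y)}.
Proof.
move=> [Dg _ cdg _ _]; have cg := is_derive_continuous (Dg z).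
by apply: cvgD; apply: cvgM; (exact: cg || exact: cdg).
Qed.

(** The first-order term of the equation is a friction: it dissipates energy. *)
Lemma energy_nonincreasing e g dg a b : bessel_ode e g dg -> 0 <= e ->
  0 <= a -> a <= b -> dg b ^+ 2 + g b ^+ 2 <= dg a ^+ 2 + g a ^+ 2.
Proof.
move=> H e0 a0 ab; rewrite !expr2 -subr_le0.
have cE x : a <= x <= b ->
    {for x, continuous (fun y => dg y * dg y + g y * g y)}.
  by move=> _; exact: continuous_energy H.
have DE x : a < x < b -> is_derive x 1 (fun y => dg y * dg y + g y * g y)
    (- (2 * e / x * dg x ^+ 2)).
  by move=> /andP[ax _]; exact: is_derive_energy H (le_lt_trans a0 ax).
have [c /andP[ac _] ->] := MVT_is_derive ab cE DE.
rewrite mulNr oppr_le0 mulr_ge0 ?subr_ge0// mulr_ge0 ?sqr_ge0//.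
by rewrite divr_ge0 ?mulr_ge0// (le_trans a0).
Qed.

Lemma bessel_ode_le1 e g dg z : bessel_ode e g dg -> 0 <= e -> 0 <= z ->
  `|g z| <= 1.
Proof.
move=> H e0 z0; have := energy_nonincreasing H e0 (lexx 0) z0.
have [_ _ _ -> ->] := H; rewrite expr0n/= add0r expr1n => E1.
rewrite -(@ler_pXn2r _ 2)// ?nnegrE// expr1n real_normK ?num_real//.
by rewrite (le_trans _ E1)// lerDr sqr_ge0.
Qed.

(** The friction cannot exhaust the energy: z^(2 e) times the energy has
derivative 2 e z^(2 e - 1) g^2 >= 0, and it is positive near 0 because g 0 = 1. *)
Lemma energy_gt0 e g dg z : bessel_ode e g dg -> 0 <= e -> 0 < z ->
  0 < dg z ^+ 2 + g z ^+ 2.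
Proof.
move=> H e0 z0; have [Dg Ddg cdg g0 dg0] := H.
have [a [a0 az ga]] : exists a, [/\ 0 < a, a <= z & 0 < g a].
  have /cvgrPdist_lt/(_ 1 ltr01) := is_derive_continuous (Dg 0).
  move=> /nbhs_ballP[r /= r0 /= B]; exists (Num.min (r / 2) z).
  have m0 : 0 < Num.min (r / 2) z by rewrite lt_min divr_gt0.
  split=> //; first by rewrite ge_min lexx orbT.
  have := B (Num.min (r / 2) z); rewrite /ball/= sub0r normrN gtr0_norm//.
  have mr : Num.min (r / 2) z < r.
    by rewrite gt_min (ltr_pdivrMr _ _ (ltr0n _ 2)) ltr_pMr// ltr1n.
  by move=> /(_ mr); rewrite g0 ltr_norml ltrBlDr => /andP[_]; lra.
pose F y := y `^ (2 * e) * (dg y * dg y + g y * g y).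
pose dF y := 2 * e / y * y `^ (2 * e) * g y ^+ 2.
have DF (x : R) : 0 < x -> is_derive x 1 F (dF x).
  move=> x0; apply: is_derive_eq
    (is_derive_mul (is_derive_powR _ x0) (is_derive_energy H x0)) _.
  by rewrite /dF; field; rewrite gt_eqF.
have FF : F a <= F z.
  apply: (@le_of_derive_ge0 R _ dF) => //.
  - move=> x /andP[ax _].
    exact: is_derive_continuous (DF _ (lt_le_trans a0 ax)).
  - by move=> x /andP[ax _]; exact: DF (lt_trans a0 ax).
  - move=> x /andP[ax _]; have x0 := lt_le_trans a0 ax.
    rewrite /dF mulr_ge0 ?sqr_ge0// mulr_ge0 ?powR_ge0//.
    by rewrite divr_ge0 ?mulr_ge0// ltW.
have : 0 < F z.
  apply: lt_le_trans FF; rewrite /F mulr_gt0 ?powR_gt0//.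
  by rewrite -!expr2 ltr_wpDl ?sqr_ge0// exprn_gt0.
by rewrite /F pmulr_rgt0 ?powR_gt0// -!expr2.
Qed.

(** By Rolle there is a critical point c between the zeros, where the energy is
(g c)^2.  From there on |g'| <= |g c|, so that g needs a length at least 1 to come
down from g c to 0. *)
Lemma bessel_ode_gap e g dg a b : bessel_ode e g dg -> 0 <= e -> 0 < a ->
  a < b -> g a = 0 -> g b = 0 -> 1 <= b - a.
Proof.
move=> H e0 a0 ab ga gb; have [Dg Ddg cdg g0 dg0] := H.
have [|||c cab Dc] := @Rolle R g a b ab.
- by move=> x _; exact: ex_derive.
- by apply: continuous_in_subspaceT => x _; exact: is_derive_continuous (Dg x).
- by rewrite ga gb.
move: cab; rewrite in_itv/= => /andP[ac cb].
have c0 := lt_trans a0 ac.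
have dgc : dg c = 0.
  have [_ <-] := Dg c; by have [_ ->] := Dc.
have := energy_gt0 H e0 c0; rewrite dgc expr0n/= add0r => gc0.
have cg x : c <= x <= b -> {for x, continuous g}.
  by move=> _; exact: is_derive_continuous (Dg x).
have [d /andP[cd _] Ed] := MVT_is_derive (ltW cb) cg (fun x _ => Dg x).
have := energy_nonincreasing H e0 (ltW c0) cd.
rewrite dgc expr0n/= add0r => dd.
have {}dd : `|dg d| <= `|g c|.
  rewrite -(@ler_pXn2r _ 2)// ?nnegrE// !real_normK ?num_real//.
  by rewrite (le_trans _ dd)// lerDl sqr_ge0.
have gc : 0 < `|g c|.
  by rewrite normr_gt0; apply: contraTneq gc0 => ->; rewrite expr0n/= ltxx.
move: Ed; rewrite gb sub0r => /(congr1 (fun x => `|x|)).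
rewrite normrN normrM (gtr0_norm (_ : 0 < b - c)) ?subr_gt0// => Ed.
have : `|g c| * 1 <= `|g c| * (b - c).
  by rewrite mulr1 {1}Ed ler_wpM2r// subr_ge0 ltW.
by rewrite ler_pM2l// => h; apply: (le_trans h); rewrite lerD2l lerN2 ltW.
Qed.

(** The function z^(e/2) g solves v'' + q v = 0 with q = 1 - s / z^2.  Let
A = v'^2 + q v^2, which is z^e g'^2 at the zeros of g.  If s >= 0, then q increases
and A' = q' v^2 >= 0.  If s < 0, then q decreases, (A / q)' = - q' (v' / q)^2 >= 0
and q >= 1.  Either way the value of A at the zeros is bounded below in terms of
its value at the first one. *)
Lemma bessel_ode_derive_ge e g dg a : bessel_ode e g dg -> 0 <= e -> 0 < a ->
  g a = 0 -> exists2 c, 0 < c &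
    forall b, a <= b -> g b = 0 -> c <= b `^ e * dg b ^+ 2.
Proof.
move=> H e0 a0 ga; have [Dg Ddg cdg g0 dg0] := H.
pose s := (e ^+ 2 - 2 * e) / 4.
(* u is z^(- e/2) times the derivative of z^(e/2) g *)
pose u y := dg y + e / 2 * (y^-1 * g y).
pose q y : R := 1 + - s * (y^-1 * y^-1).
pose A y := y `^ e * (u y * u y + q y * (g y * g y)).
have Dq (y : R) : 0 < y -> is_derive y 1 q (2 * s / y ^+ 3).
  move=> y0; have yN0 : y != 0 by rewrite gt_eqF.
  have Dy : is_derive y 1 (fun y : R => y^-1) (- 1 / y ^+ 2).
    exact: (is_derive_inv _ (is_derive_var y)).
  apply: is_derive_eq (is_derive_add (is_derive_const 1 y)
    (is_derive_mul (is_derive_const (- s) y) (is_derive_mul Dy Dy))) _.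
  by field.
have DA (y : R) : 0 < y ->
    is_derive y 1 A (y `^ e * g y ^+ 2 * (2 * s / y ^+ 3)).
  move=> y0; have yN0 : y != 0 by rewrite gt_eqF.
  have Dy : is_derive y 1 (fun y : R => y^-1) (- 1 / y ^+ 2).
    exact: (is_derive_inv _ (is_derive_var y)).
  have Du : is_derive y 1 u (- g y - e / y * dg y +
      e / 2 * (- 1 / y ^+ 2 * g y + y^-1 * dg y)).
    apply: is_derive_eq (is_derive_add (Ddg y y0)
      (is_derive_mul (is_derive_const (e / 2) y) (is_derive_mul Dy (Dg y)))) _.
    by ring.
  apply: is_derive_eq (is_derive_mul (is_derive_powR e y0)
    (is_derive_add (is_derive_mul Du Du)
      (is_derive_mul (Dq y y0) (is_derive_mul (Dg y) (Dg y))))) _.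
  by rewrite /u /q /s; field.
have dga : 0 < dg a ^+ 2.
  by have := energy_gt0 H e0 a0; rewrite ga expr0n/= addr0.
have Azero b : g b = 0 -> A b = b `^ e * dg b ^+ 2.
  by move=> gb; rewrite /A /u gb; ring.
have Aa : 0 < A a by rewrite Azero// mulr_gt0// powR_gt0.
have [s0|s0] := leP 0 s.
  exists (A a) => // b ab gb; rewrite -Azero//.
  apply: (le_of_derive_ge0 ab (f := A)
    (df := fun y => y `^ e * g y ^+ 2 * (2 * s / y ^+ 3))).
  - move=> x /andP[ax _].
    exact: is_derive_continuous (DA _ (lt_le_trans a0 ax)).
  - by move=> x /andP[ax _]; exact: DA (lt_trans a0 ax).
  - move=> x /andP[ax _]; have x0 := lt_le_trans a0 ax.
    rewrite mulr_ge0//; first by rewrite mulr_ge0 ?powR_ge0 ?sqr_ge0.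
    by rewrite divr_ge0 ?exprn_ge0 ?(ltW x0)// mulr_ge0.
have q1 y : 1 <= q y.
  rewrite lerDl mulr_ge0 ?oppr_ge0 ?(ltW s0)//.
  by rewrite -expr2 sqr_ge0.
have q0 y : 0 < q y by rewrite (lt_le_trans ltr01).
exists (A a / q a); first by rewrite divr_gt0.
move=> b ab gb; rewrite -Azero//.
have Ab0 : 0 <= A b by rewrite Azero// mulr_ge0 ?powR_ge0 ?sqr_ge0.
apply: (@le_trans _ _ (A b / q b)); last by rewrite ler_pdivrMr// ler_peMr.
have DB (x : R) : 0 < x -> is_derive x 1 (fun y => A y * (q y)^-1)
    (x `^ e * u x ^+ 2 * (- (2 * s / x ^+ 3)) / q x ^+ 2).
  move=> x0; have xN0 : x != 0 by rewrite gt_eqF.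
  have qN0 : q x != 0 by rewrite gt_eqF.
  apply: is_derive_eq
    (is_derive_mul (DA _ x0) (is_derive_inv qN0 (Dq _ x0))) _.
  by rewrite /A; field; rewrite qN0.
apply: (le_of_derive_ge0 ab (f := fun y => A y * (q y)^-1)).
- move=> x /andP[ax _].
  exact: is_derive_continuous (DB _ (lt_le_trans a0 ax)).
- by move=> x /andP[ax _]; exact: DB (lt_trans a0 ax).
- move=> x /andP[ax _]; have x0 := lt_le_trans a0 ax.
  rewrite divr_ge0 ?sqr_ge0// mulr_ge0//.
    by rewrite mulr_ge0 ?powR_ge0 ?sqr_ge0.
  by rewrite -mulNr -mulrN divr_ge0 ?exprn_ge0 ?(ltW x0)// mulr_ge0// oppr_ge0 ltW.
Qed.

End bessel_ode.

(** * The Bessel function as a power series *)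

Section exp_majorized_pseries.
Variable R : realType.
Implicit Types (c : nat -> R) (x : R).

(** A bound which is stable under termwise differentiation, and by which a power
series converges everywhere together with all its derivatives. *)
Definition exp_majorized c := forall m, `|c m| <= (m`!%:R)^-1.

Lemma exp_majorized_diffs c : exp_majorized c -> exp_majorized (pseries_diffs c).
Proof.
move=> H m; rewrite /pseries_diffs normrM ger0_norm//.
have := H m.+1; rewrite factS natrM invfM => Hm.
by rewrite -ler_pdivlMl// mulrC [_ / _]mulrC.
Qed.

Lemma exp_majorized_cvg c x : exp_majorized c -> cvgn (pseries c x).
Proof.
move=> H; apply: normed_cvg; rewrite /normed_series_of /=.
apply: (@series_le_cvg _ _ (exp_coeff `|x|)).
- by move=> n; exact: normr_ge0.
- by move=> n; rewrite exp_coeff_ge0.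
- move=> n; rewrite normrM normrX /exp_coeff/= mulrC.
  by rewrite ler_wpM2l// exprn_ge0.
- exact: is_cvg_series_exp_coeff.
Qed.

Lemma is_derive_pseries c x : exp_majorized c ->
  is_derive x 1 (fun y => limn (pseries c y)) (limn (pseries (pseries_diffs c) x)).
Proof.
move=> H; apply: (@pseries_snd_diffs _ _ (`|x| + 1)).
- exact: exp_majorized_cvg.
- by apply/exp_majorized_cvg/exp_majorized_diffs.
- by apply/exp_majorized_cvg/exp_majorized_diffs/exp_majorized_diffs.
- by rewrite [ltRHS]ger0_norm ?addr_ge0// ltrDl.
Qed.

Lemma pseries_at0 c : limn (pseries c 0) = c 0%N.
Proof.
apply: lim_near_cst => //; near=> m; rewrite -[m]prednK; last by near: m.
rewrite /pseries /series /= big_nat_recl//= expr0 mulr1 big1 ?addr0//.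
by move=> i _; rewrite expr0n mulr0.
Unshelve. all: by end_near. Qed.

End exp_majorized_pseries.

Section normalized_bessel.
Variable R : realType.
Implicit Types (nu x z : R).

Fixpoint bessel_coef nu (m : nat) : R :=
  if m is n.+1 then - bessel_coef nu n / (4 * n.+1%:R * (n.+1%:R + nu)) else 1.

Lemma exp_majorized_bessel_coef nu : 0 <= nu -> exp_majorized (bessel_coef nu).
Proof.
move=> nu0; elim=> [|n IH]; first by rewrite /= normr1 invr1.
have d0 : 0 < n.+1%:R + nu by rewrite ltr_wpDr.
rewrite /= normrM normrN normfV factS natrM invfM [X in _ <= X]mulrC.
apply: ler_pM => //.
rewrite ger0_norm ?mulr_ge0 ?(ltW d0)// lef_pV2 ?posrE ?mulr_gt0//.
rewrite mulrAC ler_peMl//.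
have : 1 <= n.+1%:R :> R by rewrite ler1n.
lra.
Qed.

(** The function 2^nu Gamma (nu + 1) z^(- nu) J_nu z. *)
Definition nbessel nu z : R := limn (pseries (bessel_coef nu) (z * z)).
Definition nbessel' nu z : R :=
  2 * z * limn (pseries (pseries_diffs (bessel_coef nu)) (z * z)).

(** For g z = f (z^2) the Bessel equation reads 4 x f'' + 4 (nu + 1) f' + f = 0.
It holds exactly for partial sums, because the coefficient of x^m in the first
series times x is that of index m - 1: the first sum has one term less. *)
Lemma bessel_coef_sum nu x n : 0 <= nu ->
  4 * x * pseries (pseries_diffs (pseries_diffs (bessel_coef nu))) x n +
  4 * (nu + 1) * pseries (pseries_diffs (bessel_coef nu)) x n.+1 +
  pseries (bessel_coef nu) x n.+1 = 0.
Proof.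
move=> nu0; rewrite /pseries /series /=; elim: n => [|n IH].
  rewrite !big_nat1 big_geq// /pseries_diffs/= !expr0.
  by field; rewrite gt_eqF// ltr_wpDr.
rewrite big_nat_recr//= [X in _ + _ * X]big_nat_recr//=.
rewrite [X in _ + X = _]big_nat_recr//=.
set a := \sum_(_ <= _ < _) _ in IH *; set b := \sum_(_ <= _ < _) _ in IH *.
set c := \sum_(_ <= _ < _) _ in IH *.
rewrite [LHS](_ : _ = (4 * x * a + 4 * (nu + 1) * b + c) +
  (4 * x * (pseries_diffs (pseries_diffs (bessel_coef nu)) n * x ^+ n) +
  4 * (nu + 1) * (pseries_diffs (bessel_coef nu) n.+1 * x ^+ n.+1) +
  bessel_coef nu n.+1 * x ^+ n.+1)); last by rewrite /=; ring.
rewrite IH add0r /pseries_diffs/=.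
set cc := bessel_coef nu n; rewrite -!nat1r.
have n0 : 0 <= n%:R :> R by [].
by rewrite exprS; field; rewrite !gt_eqF//; lra.
Qed.

Lemma bessel_ode_nbessel nu : 0 <= nu ->
  bessel_ode (2 * nu + 1) (nbessel nu) (nbessel' nu).
Proof.
move=> nu0.
have H0 := exp_majorized_bessel_coef nu0.
have H1 := exp_majorized_diffs H0.
have H2 := exp_majorized_diffs H1.
pose F c (y : R) : R := limn (pseries c y).
have Dsq c (z : R) : exp_majorized c ->
    is_derive z 1 (fun z => F c (z * z)) (2 * z * F (pseries_diffs c) (z * z)).
  move=> Hc.
  have Dz : is_derive z 1 (fun z : R => z * z) (1 * z + z * 1).
    exact: is_derive_mul (is_derive_var z) (is_derive_var z).
  have D := @is_derive1_comp R (F c) (fun z => z * z) z _ _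
    (is_derive_pseries (z * z) Hc) Dz.
  apply: is_derive_eq D _.
  by rewrite /F; ring.
have Dg1 z : is_derive z 1 (nbessel' nu)
    (2 * F (pseries_diffs (bessel_coef nu)) (z * z) +
    4 * z ^+ 2 * F (pseries_diffs (pseries_diffs (bessel_coef nu))) (z * z)).
  apply: is_derive_eq (is_derive_mul (is_derive_mul (is_derive_const 2 z)
    (is_derive_var z)) (Dsq _ z H1)) _.
  by rewrite /F; ring.
have ODE x : 4 * x * F (pseries_diffs (pseries_diffs (bessel_coef nu))) x +
    4 * (nu + 1) * F (pseries_diffs (bessel_coef nu)) x +
    F (bessel_coef nu) x = 0.
  have : (fun n => 4 * x *
      pseries (pseries_diffs (pseries_diffs (bessel_coef nu))) x n +
      4 * (nu + 1) * pseries (pseries_diffs (bessel_coef nu)) x n.+1 +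
      pseries (bessel_coef nu) x n.+1) @ \oo -->
      4 * x * F (pseries_diffs (pseries_diffs (bessel_coef nu))) x +
      4 * (nu + 1) * F (pseries_diffs (bessel_coef nu)) x +
      F (bessel_coef nu) x.
    apply: cvgD; first apply: cvgD.
    - by apply: cvgMr; exact: exp_majorized_cvg.
    - apply: cvgMr; rewrite (cvg_shiftS (pseries _ _)).
      exact: exp_majorized_cvg.
    - by rewrite (cvg_shiftS (pseries _ _)); exact: exp_majorized_cvg.
  under eq_cvg do rewrite bessel_coef_sum//.
  by move=> /(cvg_lim (@Rhausdorff R)) <-; rewrite lim_cst.
split.
- by move=> z; exact: Dsq.
- move=> z z0; apply: is_derive_eq (Dg1 z) _.
  rewrite /nbessel /nbessel' -/(F _ _) -/(F _ _).
  have -> : F (bessel_coef nu) (z * z) =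
    - (4 * (z * z) * F (pseries_diffs (pseries_diffs (bessel_coef nu))) (z * z)
    + 4 * (nu + 1) * F (pseries_diffs (bessel_coef nu)) (z * z)).
    by apply/eqP; rewrite -addr_eq0 addrC ODE.
  by field; rewrite gt_eqF.
- by move=> z; exact: is_derive_continuous (Dg1 z).
- by rewrite /nbessel mulr0 pseries_at0.
- by rewrite /nbessel' mulr0 mul0r.
Qed.

End normalized_bessel.

(** * The Gamma integral *)

Section gamma_function.
Variable R : realType.
Notation mu := (@lebesgue_measure R).
Implicit Types (p x t : R).

Let h p t : R := t `^ p * expR (- t).
Let I p : \bar R := (\int[mu]_(t in `]0%R, +oo[) (h p t)%:E)%E.

Lemma powR_cvg_right0 p : 0 <= p -> t `^ p @[t --> (0:R)^'+] --> (0:R) `^ p.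
Proof.
rewrite le_eqVlt => /predU1P[<-|p0].
  rewrite powRr0; under eq_cvg do rewrite powRr0; exact: cvg_cst.
by rewrite powR0 ?gt_eqF//; exact: powR_cvg0.
Qed.

Lemma powR_expRN_cvgy p : (t `^ p * expR (- t)) @[t --> +oo] --> (0:R).
Proof.
pose n := Num.bound `|p|.
have pn : p <= n%:R.
  exact: le_trans (ler_norm _) (ltW (archi_boundP (normr_ge0 p))).
apply/cvgrPdist_le => e e0; near=> t.
have t1 : 1 <= t by near: t; exact: nbhs_pinfty_ge.
have t0 : 0 < t by exact: lt_le_trans t1.
rewrite sub0r normrN ger0_norm ?mulr_ge0 ?powR_ge0 ?expR_ge0//.
rewrite expRN ler_pdivrMr ?expR_gt0//.
apply: (@le_trans _ _ (t ^+ n)); first by rewrite -powR_mulrn ?ler_powR// ltW.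
apply: (@le_trans _ _ (e * (t ^+ n.+1 / n.+1`!%:R))).
  rewrite exprS mulrA -ler_pdivrMr; last by rewrite invr_gt0 ltr0n fact_gt0.
  rewrite invrK mulrC mulrA ler_wpM2r ?exprn_ge0 ?(ltW t0)//.
  suff Kt : e^-1 * n.+1`!%:R <= t by rewrite -ler_pdivrMl.
  by near: t; by apply: nbhs_pinfty_ge; exact: num_real.
rewrite ler_pM2l//; apply: le_trans (expR_ge1Dxn n (ltW t0)).
by rewrite lerDr.
Unshelve. all: by end_near. Qed.

Lemma is_derive_expRN (t : R) : is_derive t 1 (fun t => expR (- t)) (- expR (- t)).
Proof.
have D : is_derive t 1 (fun t : R => - t) (- 1) by exact: is_deriveN.
have := @is_derive1_comp R expR (fun t => - t) t _ _ (is_derive_expR (- t)) D.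
by rewrite mulrN1.
Qed.

Lemma measurable_gamma_integrand p :
  measurable_fun (`]0, +oo[ : set R) (fun t => t `^ p * expR (- t)).
Proof.
apply: measurable_funM.
  exact: measurable_funTS (measurable_powR _).
apply: measurable_funTS; apply: continuous_measurable_fun => t.
exact: (is_derive_continuous (is_derive_expRN t)).
Qed.

(** Powers of t are differentiable on the open half-line but only continuous at 0,
whence the right limits. *)
Lemma integral_derive_0y (F f : R -> R) (l : R) :
  (forall t, 0 < t -> is_derive t 1 F (f t)) ->
  (forall t, 0 <= t -> 0 <= f t) ->
  (forall t, 0 < t -> {for t, continuous f}) ->
  f t @[t --> 0^'+] --> f 0 ->
  F t @[t --> 0^'+] --> F 0 -> F t @[t --> +oo] --> l ->
  (\int[mu]_(t in `]0%R, +oo[) (f t)%:E = (l - F 0)%:E)%E.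
Proof.
move=> DF f0 cf cf0 cF0 Fl.
rewrite integral_itv_obnd_cbnd; last first.
  apply/measurable_EFinP; apply: open_continuous_measurable_fun => // t.
  by rewrite inE/= in_itv/= andbT; exact: cf.
rewrite (ge0_continuous_FTC2y f0 _ Fl)//.
- apply/continuous_within_itvcyP; split=> // t; rewrite in_itv/= andbT.
  exact: cf.
- by move=> t t0; have [] := DF t t0.
- move=> t; rewrite in_itv/= andbT => t0.
  by rewrite derive1E; have [] := DF t t0.
Qed.

Lemma gamma_integrand_ge0 p t : 0 <= t `^ p * expR (- t).
Proof. by rewrite mulr_ge0 ?powR_ge0 ?expR_ge0. Qed.

Lemma gamma_integral0 : I 0 = 1%E.
Proof.
rewrite /I /h (_ : 1%E = (0 - - expR (- 0))%:E); last first.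
  by rewrite oppr0 expR0 sub0r opprK.
have D t : is_derive t 1 (fun t : R => - expR (- t)) (t `^ 0 * expR (- t)).
  apply: is_derive_eq (is_deriveN (is_derive_expRN t)) _.
  by rewrite powRr0 mul1r opprK.
have E : (fun t : R => t `^ 0 * expR (- t)) = (fun t => expR (- t)).
  by apply/funext => t; rewrite powRr0 mul1r.
have cE t : {for t, continuous (fun t => t `^ 0 * expR (- t))}.
  by rewrite E; exact: is_derive_continuous (is_derive_expRN t).
apply: (@integral_derive_0y (fun t => - expR (- t))) => //.
- by move=> t _; exact: gamma_integrand_ge0.
- by apply: cvg_at_right_filter; exact: cE.
- by apply: cvg_at_right_filter; exact: is_derive_continuous (D 0).
- by rewrite -[X in _ --> X]oppr0; apply: cvgN; exact: cvgr_expR.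
Qed.

Lemma is_derive_gamma_integrand p t : 0 < t ->
  is_derive t 1 (h p) (p / t * h p t - h p t).
Proof.
move=> t0.
apply: is_derive_eq (is_derive_mul (is_derive_powR p t0) (is_derive_expRN t)) _.
by rewrite /h; ring.
Qed.

Lemma gamma_integrand_cvg0 p : 0 <= p -> h p t @[t --> 0^'+] --> h p 0.
Proof.
move=> p0; apply: cvgM; first exact: powR_cvg_right0.
apply: (@cvg_at_right_filter _ _ (fun t => expR (- t))).
exact: is_derive_continuous (is_derive_expRN 0).
Qed.

(** Integration by parts in [0, +oo], before any integrability is known: the
primitive - t^(p + 1) e^(-t) has a derivative of variable sign, but replacing
t^(p + 1) by t^(p + 1) + C makes the derivative nonnegative. *)
Lemma gamma_integralS p : 0 <= p -> I (p + 1) = ((p + 1)%:E * I p)%E.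
Proof.
move=> p0; set x := p + 1; have x0 : 0 < x by rewrite /x; lra.
pose C := x * x `^ p.
have C0 : 0 <= C by rewrite mulr_ge0 ?powR_ge0// ltW.
have tx t : 0 <= t -> t `^ x = t * t `^ p.
  by move=> t0; rewrite -(@mulr_powRB1 R t x)// /x addrK.
pose f t := h x t + C * h 0 t - x * h p t.
pose F t := - (h x t + C * h 0 t).
have DF t : 0 < t -> is_derive t 1 F (f t).
  move=> t0; rewrite /F.
  apply: is_derive_eq (is_deriveN (is_derive_add (is_derive_gamma_integrand x t0)
   (is_derive_mul (is_derive_const C t) (is_derive_gamma_integrand 0 t0)))) _.
  by rewrite /f /h tx ?ltW//; field; rewrite gt_eqF.
have f0 t : 0 <= t -> 0 <= f t.
  move=> t0; have -> : f t = (t * t `^ p + C - x * t `^ p) * expR (- t).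
    by rewrite /f /h tx// powRr0; ring.
  rewrite mulr_ge0 ?expR_ge0// subr_ge0; have [tlex|xt] := leP t x.
    rewrite ler_wpDl ?mulr_ge0 ?powR_ge0// ler_wpM2l ?(ltW x0)//.
    by rewrite ge0_ler_powR// nnegrE// ltW.
  by rewrite ler_wpDr// ler_wpM2r ?powR_ge0// ltW.
have Df t : 0 < t -> {for t, continuous f}.
  move=> t0; have ch q : {for t, continuous (h q)}.
    exact: is_derive_continuous (is_derive_gamma_integrand q t0).
  apply: cvgB; first apply: cvgD; first exact: ch.
    by apply: cvgMr; exact: ch.
  by apply: cvgMr; exact: ch.
have Ff : (\int[mu]_(t in `]0%R, +oo[) (f t)%:E = C%:E)%E.
  rewrite (_ : C = 0 - F 0); last first.
    rewrite /F /h tx// powRr0 oppr0 expR0; ring.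
  apply: integral_derive_0y => //.
  - apply: cvgB; first apply: cvgD; first exact/gamma_integrand_cvg0/ltW.
      by apply: cvgMr; exact: gamma_integrand_cvg0.
    by apply: cvgMr; exact: gamma_integrand_cvg0.
  - apply: cvgN; apply: cvgD; first exact/gamma_integrand_cvg0/ltW.
    by apply: cvgMr; exact: gamma_integrand_cvg0.
  - rewrite (_ : 0 = - (0 + C * 0)); last by rewrite mulr0 addr0 oppr0.
    apply: cvgN; apply: cvgD; first exact: powR_expRN_cvgy.
    by apply: cvgMr; exact: powR_expRN_cvgy.
have mh q : measurable_fun (`]0%R, +oo[ : set R) (fun t => (h q t)%:E).
  by apply/measurable_EFinP; exact: measurable_gamma_integrand.
have h0 q t : (0 <= (h q t)%:E)%E by rewrite lee_fin gamma_integrand_ge0.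
have mf : measurable_fun (`]0%R, +oo[ : set R) (fun t => (f t)%:E).
  apply/measurable_EFinP; apply: measurable_funB; first apply: measurable_funD.
  - exact: measurable_gamma_integrand.
  - by apply: measurable_funM => //; exact: measurable_gamma_integrand.
  - by apply: measurable_funM => //; exact: measurable_gamma_integrand.
have E1 : (\int[mu]_(t in `]0%R, +oo[) ((f t)%:E + x%:E * (h p t)%:E) =
    C%:E + x%:E * I p)%E.
  rewrite ge0_integralD//.
  - by rewrite Ff ge0_integralZl_EFin// ?(ltW x0)//; exact: mh.
  - by move=> t /=; rewrite in_itv/= andbT lee_fin => t0; exact/f0/ltW.
  - by move=> t _; rewrite mule_ge0// lee_fin ltW.
  - by apply: measurable_funeM; exact: mh.
have E2 : (\int[mu]_(t in `]0%R, +oo[) ((h x t)%:E + C%:E * (h 0 t)%:E) =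
    I x + C%:E)%E.
  rewrite ge0_integralD//.
  - by rewrite ge0_integralZl_EFin// -/(I 0) ?gamma_integral0 ?mule1//; exact: mh.
  - exact: mh.
  - by move=> t _; rewrite mule_ge0// lee_fin.
  - by apply: measurable_funeM; exact: mh.
have : (I x + C%:E = C%:E + x%:E * I p)%E.
  rewrite -E1 -E2; apply: eq_integral => t _.
  by rewrite -!EFinM -!EFinD /f; congr EFin; ring.
move=> E; rewrite -[LHS](@addeK _ C%:E)// E addeC addeA addeC.
by rewrite (addeC (- _)%E) subee// adde0.
Qed.

(** The recurrence settles integer exponents n, and t^p <= 1 + t^n if p <= n. *)
Lemma gamma_integral_fin p : 0 <= p -> I p \is a fin_num.
Proof.
move=> p0.
have I0 q : (0 <= I q)%E.
  by apply: integral_ge0 => t _; rewrite lee_fin gamma_integrand_ge0.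
have In n : I n%:R \is a fin_num.
  elim: n => [|n IH]; first by rewrite gamma_integral0.
  by rewrite -natr1 gamma_integralS// fin_numM.
pose n := Num.bound `|p|.
have pn : p <= n%:R.
  exact: le_trans (ler_norm _) (ltW (archi_boundP (normr_ge0 p))).
have mh q : measurable_fun (`]0%R, +oo[ : set R) (fun t => (h q t)%:E).
  by apply/measurable_EFinP; exact: measurable_gamma_integrand.
have h0 q t : (0 <= (h q t)%:E)%E by rewrite lee_fin gamma_integrand_ge0.
rewrite ge0_fin_numE//; apply: (@le_lt_trans _ _ (I 0 + I n%:R)%E).
  rewrite -ge0_integralD//; [|exact: mh|exact: mh].
  apply: ge0_le_integral => //; first exact: mh.
  - by apply: emeasurable_funD; exact: mh.
  - move=> t /=; rewrite in_itv/= andbT => t0.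
    rewrite -EFinD lee_fin /h -mulrDl ler_wpM2r ?expR_ge0// powRr0.
    have [t1|t1] := leP 1 t.
      by rewrite ler_wpDl// ler_powR.
    rewrite ler_wpDr ?powR_ge0// -(powRr0 t) ger_powR//.
    by rewrite t0 ltW.
by rewrite lte_add_pinfty// -ge0_fin_numE// gamma_integral0.
Qed.

Lemma Gamma_recurrence x : 1 <= x -> Gamma (x + 1) = x * Gamma x.
Proof.
move=> x1; have p0 : 0 <= x - 1 by rewrite subr_ge0.
rewrite /Gamma /Rintegral -addrA subrr addr0.
have := gamma_integralS p0; rewrite /I /h subrK => ->.
by rewrite fineM ?fin_numE//; exact: gamma_integral_fin.
Qed.

Lemma Gamma_gt0 x : 1 <= x -> 0 < Gamma x.
Proof.
move=> x1; have p0 : 0 <= x - 1 by rewrite subr_ge0.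
rewrite /Gamma /Rintegral fine_gt0//; apply/andP; split; last first.
  by have := gamma_integral_fin p0; rewrite ge0_fin_numE// integral_ge0// => t _;
    rewrite lee_fin gamma_integrand_ge0.
apply: (@lt_le_trans _ _ (\int[mu]_(t in `[1%R, 2%R]) (expR (- 2))%:E)%E).
  rewrite integral_cst//= lebesgue_measure_itv/= lte_fin ltr1n -EFinB -EFinM.
  by rewrite lte_fin mulr_gt0 ?expR_gt0// subr_gt0 ltr1n.
apply: (@le_trans _ _ (\int[mu]_(t in `[1%R, 2%R]) (h (x - 1) t)%:E)%E).
  apply: ge0_le_integral => //.
  - apply/measurable_EFinP; apply: measurable_funS (measurable_gamma_integrand _) => //.
    by move=> t /=; rewrite !in_itv/= andbT => /andP[t1 _]; exact: lt_le_trans t1.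
  - move=> t /=; rewrite in_itv/= => /andP[t1 t2]; rewrite lee_fin /h.
    rewrite -[leLHS]mul1r ler_pM// ?expR_ge0//; last by rewrite ler_expR lerN2.
    by rewrite -[leLHS](powRr0 t) ler_powR.
apply: ge0_subset_integral => //.
- by apply/measurable_EFinP; exact: measurable_gamma_integrand.
- by move=> t _; rewrite lee_fin gamma_integrand_ge0.
- by move=> t /=; rewrite !in_itv/= andbT => /andP[t1 _]; exact: lt_le_trans t1.
Qed.

End gamma_function.

(** * Reduction of J to its normalization *)

Section besselJ_nbessel.
Variable R : realType.
Implicit Types (nu x : R).

Definition besselJ_scale nu : R := 2^-1 `^ nu / Gamma (nu + 1).

Lemma besselJ_scale_gt0 nu : 0 <= nu -> 0 < besselJ_scale nu.
Proof.
move=> nu0; rewrite divr_gt0// ?powR_gt0 ?invr_gt0//.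
by rewrite Gamma_gt0// lerDr.
Qed.

Lemma bessel_coefE nu m : 0 <= nu ->
  (-1) ^+ m / (m`!%:R * Gamma (m%:R + nu + 1)) * 4^-1 ^+ m =
  bessel_coef nu m / Gamma (nu + 1) :> R.
Proof.
move=> nu0; elim: m => [|m IH].
  by rewrite fact0 !expr0 mulr1 !mul1r add0r.
have m0 : 0 <= m%:R :> R by [].
have G0 : Gamma (m%:R + nu + 1) != 0 by rewrite gt_eqF// Gamma_gt0// lerDr addr_ge0.
have G1 : Gamma (nu + 1) != 0 by rewrite gt_eqF// Gamma_gt0// lerDr.
have f0 : m`!%:R != 0 :> R by rewrite pnatr_eq0 -lt0n fact_gt0.
have -> : bessel_coef nu m.+1 / Gamma (nu + 1) =
    - (bessel_coef nu m / Gamma (nu + 1)) / (4 * m.+1%:R * (m.+1%:R + nu)).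
  by rewrite /=; ring.
rewrite -IH factS natrM -natr1.
rewrite (_ : m%:R + 1 + nu + 1 = m%:R + nu + 1 + 1); last by ring.
rewrite Gamma_recurrence; last by rewrite lerDr addr_ge0.
rewrite !exprS; field.
by rewrite G0 f0 !gt_eqF//; lra.
Qed.

Lemma besselJ_termE nu x m : 0 <= nu -> 0 < x ->
  besselJ_term nu x m =
  besselJ_scale nu * x `^ nu * (bessel_coef nu m * (x * x) ^+ m).
Proof.
move=> nu0 x0; rewrite /besselJ_term /besselJ_scale.
have x2 : 0 < x / 2 by rewrite divr_gt0.
rewrite powRD; last by rewrite (gt_eqF x2) implybT.
rewrite -natrM powR_mulrn ?(ltW x2)// exprM powRM ?invr_ge0// ?ltW//.
have -> : (x / 2) ^+ 2 = (x * x) * 4^-1 by field.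
rewrite exprMn.
transitivity ((-1) ^+ m / (m`!%:R * Gamma (m%:R + nu + 1)) * 4^-1 ^+ m *
  (x * x) ^+ m * (x `^ nu * 2^-1 `^ nu)); first by ring.
by rewrite bessel_coefE//; ring.
Qed.

Lemma besselJE nu x : 0 <= nu -> 0 < x ->
  besselJ nu x = besselJ_scale nu * x `^ nu * nbessel nu x.
Proof.
move=> nu0 x0; rewrite /besselJ /nbessel.
rewrite (_ : series _ = fun n => besselJ_scale nu * x `^ nu *
   pseries (bessel_coef nu) (x * x) n); last first.
  apply/funext => n; rewrite /pseries /series/= mulr_sumr.
  by apply: eq_bigr => i _; exact: besselJ_termE.
apply: cvg_lim => //; apply: cvgMr.
exact/exp_majorized_cvg/exp_majorized_bessel_coef.
Qed.

Lemma besselJ_eq0 nu x : 0 <= nu -> 0 < x ->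
  besselJ nu x = 0 -> nbessel nu x = 0.
Proof.
move=> nu0 x0; rewrite besselJE// => /eqP; rewrite mulf_eq0 => /orP[|/eqP//].
by rewrite gt_eqF// mulr_gt0 ?besselJ_scale_gt0// powR_gt0.
Qed.

Lemma besselJ_derive1 nu x : 0 <= nu -> 0 < x -> nbessel nu x = 0 ->
  derive1 (besselJ nu) x = besselJ_scale nu * x `^ nu * nbessel' nu x.
Proof.
move=> nu0 x0 gx0; have [Dg _ _ _ _] := bessel_ode_nbessel nu0.
rewrite derive1E.
have D : is_derive x 1 (fun y => besselJ_scale nu * (y `^ nu * nbessel nu y))
    (besselJ_scale nu * x `^ nu * nbessel' nu x).
  apply: is_derive_eq (is_derive_mul (is_derive_const _ x)
    (is_derive_mul (is_derive_powR _ x0) (Dg x))) _.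
  by rewrite gx0; ring.
rewrite (@near_eq_derive _ _ _ _
    (fun y => besselJ_scale nu * (y `^ nu * nbessel nu y))); first by have [] := D.
near=> y; rewrite besselJE ?mulrA//.
by near: y; exact: lt_nbhsr.
Unshelve. all: by end_near. Qed.

End besselJ_nbessel.

(** * Series of nonnegative and of dominated terms *)

Section nonneg_series.
Variable R : realType.
Implicit Types (u : nat -> R).

Lemma bounded_series_cvg u N : (forall k, 0 <= u k) ->
  (forall n, \sum_(k < n) u k <= N) -> cvgn (series u).
Proof.
move=> u0 uN; apply: nondecreasing_is_cvgn.
  by apply/nondecreasing_seqP => k; rewrite seriesSr lerDl.
by exists N => _ [n _ <-]; rewrite /series/= big_mkord.
Qed.

Lemma sum_le_nneseries u n : (forall k, 0 <= u k) ->
  ((\sum_(k < n) u k)%:E <= \sum_(0 <= k <oo) (u k)%:E)%E.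
Proof.
move=> u0; rewrite -sumEFin -(big_mkord xpredT (fun k => (u k)%:E)).
by apply: nneseries_lim_ge => k _; rewrite lee_fin.
Qed.

Lemma nneseries_fin_cvg u : (forall k, 0 <= u k) ->
  (\sum_(0 <= k <oo) (u k)%:E < +oo)%E -> cvgn (series u).
Proof.
move=> u0 uoo; set S := (\sum_(0 <= k <oo) _)%E in uoo.
have Sf : S \is a fin_num.
  by rewrite ge0_fin_numE// /S; apply: nneseries_ge0 => k _ _; rewrite lee_fin.
apply: (@bounded_series_cvg _ (fine S)) => // n.
by rewrite -lee_fin fineK//; exact: sum_le_nneseries.
Qed.

End nonneg_series.

Section dominated_series.
Variable R : realType.
Implicit Types (u M : nat -> R).

Lemma dominated_series_cvg u M : (forall k, `|u k| <= M k) -> cvgn (series M) ->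
  cvgn (series u).
Proof.
move=> uM cM; apply: normed_cvg; rewrite /normed_series_of /=.
by apply: series_le_cvg cM => // n; exact: le_trans (uM n).
Qed.

Lemma dominated_series_tail u M n : (forall k, `|u k| <= M k) ->
  cvgn (series M) ->
  `|limn (series u) - series u n| <= limn (series M) - series M n.
Proof.
move=> uM cM; have cu := dominated_series_cvg uM cM.
have c1 : (fun m => `|series u m - series u n|) @ \oo -->
    `|limn (series u) - series u n|.
  by apply: cvg_norm; apply: cvgB => //; exact: cvg_cst.
apply: (cvgr_to_le c1); near=> m.
have nm : (n <= m)%N by near: m; exact: nbhs_infty_ge.
apply: (@le_trans _ _ (series M m - series M n)).
  rewrite !sub_series_geq// (le_trans (ler_norm_sum _ _ _))//.
  by apply: ler_sum => k _; exact: uM.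
rewrite lerD2r; apply: nondecreasing_cvgn_le => //.
apply/nondecreasing_seqP => k; rewrite seriesSr lerDl.
exact: le_trans (uM k).
Unshelve. all: by end_near. Qed.

Lemma series_tail_cvg0 M : cvgn (series M) ->
  (fun n => limn (series M) - series M n) @ \oo --> (0:R).
Proof.
move=> cM; rewrite -(subrr (limn (series M))).
by apply: cvgB => //; exact: cvg_cst.
Qed.

(** Tannery's theorem: cut the three series at a common n where the tail of the
majorant is small. *)
Lemma cvg_dominated_series (F : set_system R) {FF : Filter F}
    (u : nat -> R -> R) (l M : nat -> R) :
  (forall k, u k x @[x --> F] --> l k) -> (forall k, `|l k| <= M k) ->
  (\forall x \near F, forall k, `|u k x| <= M k) -> cvgn (series M) ->
  limn (series (u ^~ x)) @[x --> F] --> limn (series l).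
Proof.
move=> ul lM uM cM; apply/cvgrPdist_lt => e e0.
have e3 : 0 < e / 3 by rewrite divr_gt0.
have /cvgrPdist_lt/(_ _ e3)[n _ /(_ n (leqnn n))/= Hn] := series_tail_cvg0 cM.
have {}Hn : limn (series M) - series M n < e / 3.
  by move: Hn; rewrite sub0r normrN; apply: le_lt_trans; exact: ler_norm.
have Sn : (fun x => series (u ^~ x) n) @ F --> series l n.
  rewrite /series/= big_mkord (_ : (fun x => _) =
    (fun x => \sum_(k < n) u k x)); first exact: cvg_sum_ord.
  by apply/funext => x; rewrite big_mkord.
move/cvgrPdist_lt/(_ _ e3) in Sn.
near=> x.
have Hx : `|series l n - series (u ^~ x) n| < e / 3 by near: x.
have ux : forall k, `|u k x| <= M k by near: x.
have t1 := dominated_series_tail n lM cM.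
have t2 := dominated_series_tail n ux cM.
rewrite (_ : _ - _ = (limn (series l) - series l n) +
  (series l n - series (u ^~ x) n) -
  (limn (series (u ^~ x)) - series (u ^~ x) n)); last by ring.
rewrite (le_lt_trans (ler_normB _ _))//.
have := ler_normD (limn (series l) - series l n) (series l n - series (u ^~ x) n).
lra.
Unshelve. all: by end_near. Qed.

End dominated_series.

(** * Complex limits by components *)

Section complex_topology.
Variable R : realType.
Local Open Scope complex_scope.
Implicit Types (z : R[i]).

Lemma normc_sqr z : normc z ^+ 2 = complex.Re z ^+ 2 + complex.Im z ^+ 2.
Proof. by case: z => a b /=; rewrite sqr_sqrtr// addr_ge0 ?sqr_ge0. Qed.

Lemma normc_ge0 z : 0 <= normc z.
Proof. by case: z => a b /=; exact: sqrtr_ge0. Qed.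

Lemma normRe_le z : `|complex.Re z| <= normc z.
Proof.
rewrite -(@ler_pXn2r _ 2)// ?nnegrE ?normc_ge0// normc_sqr real_normK ?num_real//.
by rewrite lerDl sqr_ge0.
Qed.

Lemma normIm_le z : `|complex.Im z| <= normc z.
Proof.
rewrite -(@ler_pXn2r _ 2)// ?nnegrE ?normc_ge0// normc_sqr real_normK ?num_real//.
by rewrite lerDr sqr_ge0.
Qed.

Lemma normc_le z : normc z <= `|complex.Re z| + `|complex.Im z|.
Proof.
rewrite -(@ler_pXn2r _ 2)// ?nnegrE ?normc_ge0 ?addr_ge0// normc_sqr.
rewrite -(real_normK (num_real (complex.Re z))) -(real_normK (num_real (complex.Im z))) sqrrD.
by rewrite -addrA lerD2l lerDr mulrn_wge0// mulr_ge0.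
Qed.

Lemma normr_normc z : `|z| = (normc z)%:C.
Proof. by case: z => a b; rewrite normc_def. Qed.

Lemma cvg_complex T (F : set_system T) {FF : Filter F} (f g : T -> R) (a b : R) :
  f @ F --> a -> g @ F --> b ->
  (fun x => (f x +i* g x : R[i]^o)) @ F --> (a +i* b : R[i]^o).
Proof.
move=> fa gb; apply/cvgrPdist_lt => e; rewrite ltcE/= => /andP[/eqP ei er].
have er2 : 0 < complex.Re e / 2 by rewrite divr_gt0.
move/cvgrPdist_lt/(_ _ er2) in fa; move/cvgrPdist_lt/(_ _ er2) in gb.
apply: filterS2 fa gb => x fx gx; rewrite normr_normc ltcE/= ei eqxx/=.
apply: le_lt_trans (normc_le (_ +i* _)) _ => /=; lra.
Qed.

Lemma cvg_Re T (F : set_system T) {FF : Filter F} (f : T -> R[i]^o) (l : R[i]^o) :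
  f @ F --> l -> (fun x => complex.Re (f x)) @ F --> (complex.Re l : R).
Proof.
move=> fl; apply/cvgrPdist_lt => e e0.
have ec : 0 < e%:C by rewrite ltcR.
move/cvgrPdist_lt/(_ _ ec) in fl.
apply: filterS fl => x; rewrite normr_normc ltcR; apply: le_lt_trans.
by rewrite (le_trans _ (normRe_le _))//; case: (f x) (l) => ? ? [].
Qed.

Lemma cvg_Im T (F : set_system T) {FF : Filter F} (f : T -> R[i]^o) (l : R[i]^o) :
  f @ F --> l -> (fun x => complex.Im (f x)) @ F --> (complex.Im l : R).
Proof.
move=> fl; apply/cvgrPdist_lt => e e0.
have ec : 0 < e%:C by rewrite ltcR.
move/cvgrPdist_lt/(_ _ ec) in fl.
apply: filterS fl => x; rewrite normr_normc ltcR; apply: le_lt_trans.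
by rewrite (le_trans _ (normIm_le _))//; case: (f x) (l) => ? ? [].
Qed.

Lemma Re_sum_real n (a : nat -> R[i]) (p : nat -> R) :
  complex.Re (\sum_(k < n) a k * (p k)%:C) = \sum_(k < n) complex.Re (a k) * p k.
Proof.
elim: n => [|n IH]; first by rewrite !big_ord0.
rewrite !big_ord_recr/= -IH; case: (\sum_(_ < _) _) (a n) => ? ? [? ?]/=.
by rewrite mulr0 subr0.
Qed.

Lemma Im_sum_real n (a : nat -> R[i]) (p : nat -> R) :
  complex.Im (\sum_(k < n) a k * (p k)%:C) = \sum_(k < n) complex.Im (a k) * p k.
Proof.
elim: n => [|n IH]; first by rewrite !big_ord0.
rewrite !big_ord_recr/= -IH; case: (\sum_(_ < _) _) (a n) => ? ? [? ?]/=.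
by rewrite mulr0 add0r.
Qed.

End complex_topology.

(** * Integrals over the unit interval *)

Section unit_interval_integrals.
Variable R : realType.
Notation mu := (@lebesgue_measure R).

Lemma integral_continuous_eq0 (D : R -> R) :
  {in `]0, 1[, continuous D} -> (forall x, 0 < x < 1 -> 0 <= D x) ->
  (\int[mu]_(x in `]0%R, 1%R[) (D x)%:E = 0)%E ->
  forall x, 0 < x < 1 -> D x = 0.
Proof.
move=> cD D0 I0 x0 x01; apply/eqP/negPn/negP => Dx0.
have Dp : 0 < D x0 / 2 by rewrite divr_gt0// lt_neqAle eq_sym Dx0 D0.
have x0i : x0 \in `]0, 1[%R by rewrite in_itv.
have /cvgrPdist_lt/(_ _ Dp)/nbhs_ballP[r /= r0 B] := cD _ x0i.
have [/andP[x00 x1]] := (x01, tt) => _.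
pose m := Num.min (r / 2) (Num.min (x0 / 2) ((1 - x0) / 2)).
have m0 : 0 < m by rewrite !lt_min !divr_gt0// subr_gt0.
have m1 : m <= r / 2 by rewrite ge_min lexx.
have m2 : m <= x0 / 2 by rewrite !ge_min lexx ?orbT.
have m3 : m <= (1 - x0) / 2 by rewrite !ge_min lexx ?orbT.
have sub x : x0 - m <= x <= x0 + m -> 0 < x < 1.
  by move=> /andP[h1 h2]; apply/andP; split; lra.
have DD x : x0 - m <= x <= x0 + m -> D x0 / 2 <= D x.
  move=> /andP[h1 h2]; have : `|D x0 - D x| < D x0 / 2.
    by apply: B; rewrite /ball/= ltr_norml; apply/andP; split; lra.
  by rewrite ltr_norml => /andP[_]; lra.
have mD : measurable_fun (`]0, 1[ : set R) (fun x => (D x)%:E).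
  apply/measurable_EFinP; apply: open_continuous_measurable_fun => // x.
  by rewrite inE; exact: cD.
have : (\int[mu]_(x in `[(x0 - m)%R, (x0 + m)%R]) (D x0 / 2)%:E <=
    \int[mu]_(x in `]0%R, 1%R[) (D x)%:E)%E.
  apply: (@le_trans _ _ (\int[mu]_(x in `[(x0 - m)%R, (x0 + m)%R]) (D x)%:E)%E).
    apply: ge0_le_integral => //.
    - by move=> x _; rewrite lee_fin ltW.
    - apply: measurable_funS mD => // x /=; rewrite !in_itv/=; exact: sub.
  apply: ge0_subset_integral => //.
rewrite I0 integral_cst//= lebesgue_measure_itv/= lte_fin.
rewrite (_ : x0 - m < x0 + m); last lra.
rewrite -EFinB -EFinM lee_fin leNgt mulr_gt0//; lra.
Qed.

Lemma integral_powR01 (q : R) : -1 < q ->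
  (\int[mu]_(x in `]0%R, 1%R[) (x `^ q)%:E < +oo)%E.
Proof.
move=> q1; have q0 : 0 < q + 1 by lra.
pose F (n : nat) : set R := `[n.+1%:R^-1, 1]%classic.
have UF : \bigcup_n F n = `]0, 1]%classic.
  apply/seteqP; split => x /=.
    move=> [n _]; rewrite /F /= !in_itv/= => /andP[nx ->].
    by rewrite (lt_le_trans _ nx)// invr_gt0.
  rewrite in_itv/= => /andP[x0 x1]; exists (Num.bound x^-1) => //.
  rewrite /F /= in_itv/= x1 andbT invf_ple ?posrE//.
  rewrite (le_trans (ltW (archi_boundP _)))// ?invr_ge0 ?(ltW x0)//.
  by rewrite ler_nat.
have mp A : measurable A -> measurable_fun A (fun x : R => (x `^ q)%:E).
  move=> mA; apply/measurable_EFinP; apply: measurable_funTS.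
  exact: measurable_powR.
have ndF : nondecreasing_seq F.
  move=> m n mn; rewrite subsetEset => x; rewrite /F /= !in_itv/= => /andP[mx ->].
  by rewrite andbT (le_trans _ mx)// lef_pV2 ?posrE// ler_nat.
have H : (\int[mu]_(x in F n) (x `^ q)%:E)%E @[n --> \oo] -->
    (\int[mu]_(x in `]0%R, 1%R]) (x `^ q)%:E)%E.
  rewrite -UF; apply: ge0_nondecreasing_set_cvg_integral => //.
  - by move=> i; exact: measurable_itv.
  - by move=> i; apply: mp; exact: measurable_itv.
  - by move=> i x _; rewrite lee_fin powR_ge0.
apply: (@le_lt_trans _ _ (\int[mu]_(x in `]0%R, 1%R]) (x `^ q)%:E)%E).
  apply: ge0_subset_integral => //; first exact: mp.
    by move=> x _; rewrite lee_fin powR_ge0.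
  by move=> x /=; rewrite !in_itv/= => /andP[-> /ltW].
apply: (@le_lt_trans _ _ (q + 1)^-1%:E); last exact: ltry.
apply: (cvge_to_le H); near=> n.
have a0 : 0 < n.+1%:R^-1 :> R by rewrite invr_gt0.
have [a1|] := ltP (n.+1%:R^-1 : R) 1; last first.
  rewrite /F le_eqVlt => /predU1P[<-|a1].
    by rewrite set_itv1 integral_set1 lee_fin invr_ge0 ltW.
  rewrite set_itv_ge ?integral_set0 ?lee_fin ?invr_ge0 ?ltW//.
  by rewrite bnd_simp -ltNge.
have DP (x : R) : 0 < x -> is_derive x 1 (fun x => (q + 1)^-1 * x `^ (q + 1)) (x `^ q).
  move=> x0; apply: is_derive_eq (is_derive_mul (is_derive_const _ x)
    (is_derive_powR (q + 1) x0)) _.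
  rewrite powRD ?(gt_eqF x0) ?implybT// powRr1 ?ltW//.
  by field; rewrite !gt_eqF.
have cP (x : R) : 0 < x -> {for x, continuous (fun x => (q + 1)^-1 * x `^ (q + 1))}.
  by move=> x0; exact: is_derive_continuous (DP x x0).
rewrite (@continuous_FTC2 R _ (fun x => (q + 1)^-1 * x `^ (q + 1)))//.
- rewrite powR1 mulr1 -EFinB lee_fin gerBl mulr_ge0 ?powR_ge0//.
  by rewrite invr_ge0 ltW.
- apply: continuous_in_subspaceT => x; rewrite inE/= in_itv/= => /andP[ax _].
  apply: is_derive_continuous (is_derive_powR q (lt_le_trans a0 ax)).
- split.
  + move=> x; rewrite in_itv/= => /andP[ax _].
    by have [] := DP x (lt_trans a0 ax).
  + by apply: cvg_at_right_filter; exact: cP.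
  + by apply: cvg_at_left_filter; exact: cP.
- move=> x; rewrite in_itv/= => /andP[ax _]; rewrite derive1E.
  by have [] := DP x (lt_trans a0 ax).
Unshelve. all: by end_near. Qed.

End unit_interval_integrals.

(** * Ingham's direct inequality *)

Section ingham.
Variable R : realType.
Notation mu := (@lebesgue_measure R).
Implicit Types (t T S xi delta : R) (gam x : nat -> R).

Lemma is_derive_sum_ord n (h : nat -> R -> R) (dh : nat -> R) (t : R) :
  (forall i, is_derive t 1 (h i) (dh i)) ->
  is_derive t 1 (fun y => \sum_(i < n) h i y) (\sum_(i < n) dh i).
Proof.
move=> Dh; elim: n => [|n IH].
  rewrite big_ord0 (_ : (fun _ => _) = fun=> 0); first exact: is_derive_const.
  by apply/funext => y; rewrite big_ord0.
rewrite big_ord_recr/= (_ : (fun _ => _) =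
    fun y => \sum_(i < n) h i y + h n y); first exact: is_derive_add.
by apply/funext => y; rewrite big_ord_recr.
Qed.

Lemma integral_is_derive (F f : R -> R) S : 0 < S ->
  (forall t, is_derive t 1 F (f t)) -> continuous f ->
  (\int[mu]_(t in `[0%R, S]) (f t)%:E = (F S - F 0)%:E)%E.
Proof.
move=> S0 DF cf.
have cF t : {for t, continuous F} by exact: is_derive_continuous (DF t).
rewrite (@continuous_FTC2 R f F) ?EFinB//.
- exact: continuous_subspaceT.
- split.
  + by move=> t _; have [] := DF t.
  + by apply: cvg_at_right_filter; exact: cF.
  + by apply: cvg_at_left_filter; exact: cF.
- by move=> t _; rewrite derive1E; have [] := DF t.
Qed.

Lemma is_derive_cosM xi t : is_derive t 1 (fun t => cos (xi * t)) (- (xi * sin (xi * t))).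
Proof.
have D : is_derive t 1 (fun t : R => xi * t) xi.
  apply: is_derive_eq (is_derive_mul (is_derive_const xi t) (is_derive_var t)) _.
  by ring.
apply: is_derive_eq (@is_derive1_comp R (@cos R) (fun t => xi * t) t _ _
  (is_derive_cos _) D) _.
by ring.
Qed.

Lemma is_derive_sinM xi t : is_derive t 1 (fun t => sin (xi * t)) (xi * cos (xi * t)).
Proof.
have D : is_derive t 1 (fun t : R => xi * t) xi.
  apply: is_derive_eq (is_derive_mul (is_derive_const xi t) (is_derive_var t)) _.
  by ring.
apply: is_derive_eq (@is_derive1_comp R (@sin R) (fun t => xi * t) t _ _
  (is_derive_sin _) D) _.
by ring.
Qed.

Lemma continuous_cos_sum gam x n :
  continuous (fun t => \sum_(k < n) x k * cos (gam k * t)).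
Proof.
move=> t; apply: (@cvg_sum_ord _ _ _ _ n (fun k t => x k * cos (gam k * t))
  (fun k => x k * cos (gam k * t))) => k.
by apply: cvgMr; exact: is_derive_continuous (is_derive_cosM _ _).
Qed.

Lemma continuous_sin_sum gam x n :
  continuous (fun t => \sum_(k < n) x k * sin (gam k * t)).
Proof.
move=> t; apply: (@cvg_sum_ord _ _ _ _ n (fun k t => x k * sin (gam k * t))
  (fun k => x k * sin (gam k * t))) => k.
by apply: cvgMr; exact: is_derive_continuous (is_derive_sinM _ _).
Qed.

(** A primitive in t of (S^2 - t^2) cos (xi t).  The factor S^2 - t^2 is even and
vanishes at S, so the value at S decays like xi^(-2) and the value at 0 is 0. *)
Definition window_primitive S xi t : R :=
  if xi == 0 then S ^+ 2 * t - t ^+ 3 / 3 else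
  (S ^+ 2 - t ^+ 2) * sin (xi * t) / xi - 2 * t * cos (xi * t) / xi ^+ 2 +
  2 * sin (xi * t) / xi ^+ 3.

Lemma is_derive_window_primitive S xi t :
  is_derive t 1 (window_primitive S xi) ((S ^+ 2 - t ^+ 2) * cos (xi * t)).
Proof.
have Dt := is_derive_var t.
have Dc c := is_derive_const (c : R) t.
rewrite /window_primitive; have [->|xi0] := eqVneq xi 0.
  rewrite mul0r cos0 mulr1.
  rewrite (_ : (fun _ => _) = fun t => S ^+ 2 * t + (- 3^-1) * (t * (t * t))); last first.
    by apply/funext => y; field.
  apply: is_derive_eq (is_derive_add (is_derive_mul (Dc _) Dt)
    (is_derive_mul (Dc _) (is_derive_mul Dt (is_derive_mul Dt Dt)))) _.
  by field.
rewrite (_ : (fun _ => _) = fun t => (S ^+ 2 + (- 1) * (t * t)) * (xi^-1 * sin (xi * t))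
   + ((- 2 * xi ^- 2 * t) * cos (xi * t) + 2 * xi ^- 3 * sin (xi * t))); last first.
  by apply/funext => y; field.
apply: is_derive_eq (is_derive_add (is_derive_mul (is_derive_add (Dc _)
    (is_derive_mul (Dc _) (is_derive_mul Dt Dt)))
    (is_derive_mul (Dc _) (is_derive_sinM xi t)))
  (is_derive_add (is_derive_mul (is_derive_mul (Dc _) Dt) (is_derive_cosM xi t))
    (is_derive_mul (Dc _) (is_derive_sinM xi t)))) _.
by field.
Qed.

Lemma window_primitive0 S xi : window_primitive S xi 0 = 0.
Proof.
rewrite /window_primitive; case: ifP => _; first by rewrite mulr0 expr0n/= mul0r subr0.
by rewrite !mulr0 sin0 !mulr0 !mul0r subr0 addr0.
Qed.

Lemma normr_window_primitive S xi delta : 0 < S -> 0 < delta -> delta <= `|xi| ->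
  `|window_primitive S xi S| <= (2 * S + 2 / delta) / xi ^+ 2.
Proof.
move=> S0 d0 dxi; have xi0 : xi != 0 by rewrite -normr_gt0 (lt_le_trans d0).
rewrite /window_primitive (negbTE xi0) subrr mul0r mul0r sub0r.
rewrite (le_trans (ler_normD _ _))// normrN (mulrDl (2 * S)) lerD//.
  rewrite normrM normfV (ger0_norm (sqr_ge0 xi)) ler_wpM2r ?invr_ge0 ?sqr_ge0//.
  rewrite normrM ger0_norm ?mulr_ge0 ?(ltW S0)// ler_piMr ?mulr_ge0 ?(ltW S0)//.
  by rewrite ler_norml cos_geN1 cos_le1.
rewrite normrM normfV exprS (normrM xi) (ger0_norm (sqr_ge0 xi)) invfM mulrA.
rewrite ler_wpM2r ?invr_ge0 ?sqr_ge0//.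
rewrite normrM ger0_norm// ler_pM ?mulr_ge0 ?invr_ge0//.
  by rewrite ler_piMr// ler_norml sin_geN1 sin_le1.
by rewrite lef_pV2 ?posrE ?normr_gt0.
Qed.

Definition inv_sqdist (k l : nat) : R :=
  if k == l then 0 else ((k%:R - l%:R) ^+ 2)^-1.

Lemma inv_sqdistC k l : inv_sqdist k l = inv_sqdist l k.
Proof. by rewrite /inv_sqdist eq_sym -sqrrN opprB. Qed.

Lemma inv_sqdist_ge0 k l : 0 <= inv_sqdist k l.
Proof. by rewrite /inv_sqdist; case: ifP => // _; rewrite invr_ge0 sqr_ge0. Qed.

Lemma natr_dist_ge1 (k l : nat) : k != l -> 1 <= `|k%:R - l%:R| :> R.
Proof.
move=> kl; wlog lk : k l kl / (l < k)%N => [H|].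
  have [|kl'|E] := ltngtP l k; first exact: H.
    by rewrite distrC; apply: H => //; rewrite eq_sym.
  by rewrite E eqxx in kl.
by rewrite -natrB ?(ltnW lk)// ger0_norm// ler1n subn_gt0.
Qed.

(** The inequality 1 / d^2 <= 1 / (d - 1/2) - 1 / (d + 1/2) holds for every nonzero
integer d, positive or negative, so a single telescoping sum covers both sides of
k; its term of index l = k is - 4, which has to be compensated. *)
Lemma sum_inv_sqdist k n : \sum_(l < n) inv_sqdist k l <= 6.
Proof.
pose phi (l : nat) : R := (k%:R - l%:R + 2^-1)^-1.
have H l : inv_sqdist k l <= (phi l.+1 - phi l) + (if l == k then 4 else 0).
  rewrite /inv_sqdist eq_sym; case: eqP => [->|/eqP lk].
    rewrite /phi -natr1 (_ : k%:R - (k%:R + 1) + 2^-1 = - 2^-1); last by field.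
    by rewrite subrr add0r invrN !invrK; lra.
  rewrite addr0 /phi -natr1.
  have := natr_dist_ge1 lk; rewrite distrC.
  set d := k%:R - l%:R => d1.
  have d2 : 1 <= d ^+ 2.
    by rewrite -(real_normK (num_real d)) -(expr1n _ 2%N) ler_pXn2r ?nnegrE.
  have h1 : d - 2^-1 != 0 by apply: contraTneq d2 => h; rewrite -ltNge; nra.
  have h2 : d + 2^-1 != 0 by apply: contraTneq d2 => h; rewrite -ltNge; nra.
  rewrite (_ : k%:R - (l%:R + 1) + 2^-1 = d - 2^-1); last by rewrite /d; field.
  have -> : (d - 2^-1)^-1 - (d + 2^-1)^-1 = (d ^+ 2 - 4^-1)^-1.
    rewrite (_ : d ^+ 2 - 4^-1 = (d - 2^-1) * (d + 2^-1)); last by field.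
    have : (d + 2^-1) - (d - 2^-1) = 1 by field.
    move: (d - 2^-1) (d + 2^-1) h1 h2 => a b a0 b0 ba.
    by rewrite -[RHS]mul1r -ba; field; rewrite a0 b0.
  by rewrite lef_pV2 ?posrE; lra.
apply: le_trans (ler_sum _ (fun (i : 'I_n) _ => H i)) _.
rewrite big_split/= -(big_mkord xpredT (fun i => phi i.+1 - phi i)) telescope_sumr//.
have phi0 : 0 <= phi 0%N by rewrite invr_ge0 subr0 addr_ge0.
have phin : phi n <= 2.
  rewrite /phi; have [nk|kn] := leqP n k.
    have : 0 <= k%:R - n%:R :> R by rewrite subr_ge0 ler_nat.
    set d := _ - _ => d0; rewrite -[leRHS]invrK lef_pV2 ?posrE; lra.
  have : k%:R + 1 <= n%:R :> R by rewrite natr1 ler_nat.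
  move=> h; apply: (@le_trans _ _ 0) => //; rewrite invr_le0; lra.
have : \sum_(i < n) (if i == k :> nat then 4 else 0) <= 4 :> R.
  rewrite -big_mkcond/=; have [kn|nk] := ltnP k n.
    by rewrite (big_pred1 (Ordinal kn)).
  by rewrite big_pred0// => i; rewrite ltn_eqF// (leq_trans (ltn_ord i)).
lra.
Qed.

Lemma gap_dist gam delta (k l : nat) : 0 < delta ->
  (forall i, delta <= gam i.+1 - gam i) ->
  delta * `|k%:R - l%:R| <= `|gam k - gam l|.
Proof.
move=> d0 H; wlog lk : k l / (l <= k)%N => [W|].
  have [lk|kl] := leqP l k; first exact: W.
  by rewrite distrC (distrC (gam k)); exact/W/ltnW.
suff : delta * (k%:R - l%:R) <= gam k - gam l.
  move=> h; apply: le_trans (ler_norm _); apply: le_trans h.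
  by rewrite ger0_norm// subr_ge0 ler_nat.
elim: k lk => [|k IH]; first by rewrite leqn0 => /eqP->; rewrite !subrr mulr0.
rewrite leq_eqVlt => /predU1P[->|]; first by rewrite !subrr mulr0.
rewrite ltnS => /IH h; have := H k; rewrite -natr1; lra.
Qed.

(** Schur's test: 2 |x_k x_l| <= x_k^2 + x_l^2, and the rows of the symmetric
majorant M of the matrix have bounded sums because |gam_k - gam_l| >= delta |k - l|. *)
Lemma sum_window_le gam x S delta n : 0 < S -> 0 < delta ->
  (forall i, delta <= gam i.+1 - gam i) ->
  \sum_(k < n) \sum_(l < n) x k * x l * window_primitive S (gam k - gam l) S <=
  (2 * S ^+ 3 / 3 + (2 * S + 2 / delta) / delta ^+ 2 * 6) *
    \sum_(k < n) x k ^+ 2.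
Proof.
move=> S0 d0 H.
set D := 2 * S ^+ 3 / 3; set K := (2 * S + 2 / delta) / delta ^+ 2.
have D0 : 0 <= D by rewrite /D divr_ge0// mulr_ge0// exprn_ge0// ltW.
have K0 : 0 <= K.
  by rewrite /K divr_ge0 ?sqr_ge0// addr_ge0 ?divr_ge0 ?mulr_ge0 ?ltW.
pose M (k l : nat) := (if l == k then D else 0) + K * inv_sqdist k l.
have M0 k l : 0 <= M k l.
  apply: addr_ge0; first by case: (l == k).
  exact: mulr_ge0 K0 (inv_sqdist_ge0 _ _).
have MC k l : M k l = M l k by rewrite /M inv_sqdistC eq_sym.
have PM k l : `|window_primitive S (gam k - gam l) S| <= M k l.
  rewrite /M; have [->|lk] := eqVneq l k.
    rewrite /inv_sqdist eqxx mulr0 addr0 subrr /window_primitive eqxx.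
    rewrite (_ : _ - _ = D) ?ger0_norm//; by rewrite /D; field.
  rewrite add0r /inv_sqdist eq_sym (negbTE lk).
  have kl1 : 1 <= `|k%:R - l%:R| :> R by apply: natr_dist_ge1; rewrite eq_sym.
  have g := gap_dist k l d0 H.
  have dg : delta <= `|gam k - gam l|.
    by apply: le_trans g; rewrite ler_peMr// ltW.
  apply: le_trans (normr_window_primitive S0 d0 dg) _.
  rewrite /K -mulrA -invfM -exprMn ler_wpM2l//.
    by rewrite addr_ge0 ?divr_ge0 ?mulr_ge0 ?ltW.
  rewrite -(real_normK (num_real (gam k - gam l))).
  rewrite -(real_normK (num_real (delta * _))) normrM (gtr0_norm d0).
  have kl0 : 0 < delta * `|k%:R - l%:R| by rewrite mulr_gt0// (lt_le_trans ltr01).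
  rewrite lef_pV2 ?posrE ?exprn_gt0 ?(lt_le_trans kl0 g)//.
  by rewrite ler_pXn2r ?nnegrE ?(ltW kl0).
have row k : \sum_(l < n) M k l <= D + K * 6.
  rewrite big_split/= lerD//; last first.
    by rewrite -mulr_sumr ler_wpM2l// sum_inv_sqdist.
  rewrite -big_mkcond/=; have [kn|nk] := ltnP k n.
    by rewrite (big_pred1 (Ordinal kn)).
  by rewrite big_pred0// => i; rewrite ltn_eqF// (leq_trans (ltn_ord i)).
apply: (@le_trans _ _ (\sum_(k < n) \sum_(l < n)
    (x k ^+ 2 * M k l / 2 + x l ^+ 2 * M l k / 2))).
  apply: ler_sum => k _; apply: ler_sum => l _.
  rewrite (le_trans (ler_norm _))// normrM.
  rewrite (le_trans (ler_wpM2l (normr_ge0 _) (PM k l)))// [M l k]MC -mulrDl -mulrDl.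
  rewrite mulrAC ler_wpM2r// normrM.
  rewrite -(real_normK (num_real (x k))) -(real_normK (num_real (x l))).
  have : 0 <= (`|x k| - `|x l|) ^+ 2 by exact: sqr_ge0.
  lra.
rewrite (eq_bigr (fun k : 'I_n => (\sum_(l < n) x k ^+ 2 * M k l / 2) +
  (\sum_(l < n) x l ^+ 2 * M l k / 2))); last first.
  by move=> k _; rewrite big_split.
rewrite big_split/= [X in _ + X]exchange_big/= -mulr2n -sumrMnl mulr_sumr; apply: ler_sum => k _.
rewrite -mulr_suml -mulr_sumr.
rewrite (_ : _ *+ 2 = x k ^+ 2 * \sum_(l < n) M k l); last by field.
by rewrite mulrC ler_wpM2r ?sqr_ge0.
Qed.

(** Ingham's direct inequality.  The cosine sum and the sine sum are taken with the
same coefficients because their squares then add up to a double sum of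
x_k x_l cos ((gam_k - gam_l) t), without sums of frequencies. *)
Lemma ingham_upper gam delta T : 0 < delta -> 0 < T ->
  (forall i, delta <= gam i.+1 - gam i) ->
  exists2 C, 0 < C & forall n x,
  (\int[mu]_(t in `[0%R, T])
    ((\sum_(k < n) x k * cos (gam k * t)) ^+ 2 +
     (\sum_(k < n) x k * sin (gam k * t)) ^+ 2)%:E <=
   (C * \sum_(k < n) x k ^+ 2)%:E)%E.
Proof.
(* with S = 2 T, the weight S^2 - t^2 is at least 3 T^2 on [0, T] *)
move=> d0 T0 H; pose S := 2 * T; have S0 : 0 < S by rewrite mulr_gt0.
pose C := 2 * S ^+ 3 / 3 + (2 * S + 2 / delta) / delta ^+ 2 * 6.
have C0 : 0 < C.
  rewrite /C ltr_pwDl//; first by rewrite divr_gt0// mulr_gt0// exprn_gt0.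
  by rewrite mulr_ge0// divr_ge0 ?sqr_ge0// addr_ge0 ?divr_ge0 ?mulr_ge0 ?ltW.
have T2 : 0 < 3 * T ^+ 2 by rewrite mulr_gt0// exprn_gt0.
exists (C / (3 * T ^+ 2)); first by rewrite divr_gt0.
move=> n x.
pose c t := \sum_(k < n) x k * cos (gam k * t).
pose s t := \sum_(k < n) x k * sin (gam k * t).
pose q t := c t ^+ 2 + s t ^+ 2.
have q0 t : 0 <= q t by rewrite addr_ge0 ?sqr_ge0.
pose Q t := \sum_(k < n) \sum_(l < n)
  x k * x l * window_primitive S (gam k - gam l) t.
have DQ t : is_derive t 1 Q ((S ^+ 2 - t ^+ 2) * q t).
  have -> : (S ^+ 2 - t ^+ 2) * q t = \sum_(k < n) \sum_(l < n)
     x k * x l * ((S ^+ 2 - t ^+ 2) * cos ((gam k - gam l) * t)).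
    rewrite /q !expr2 -!/(_ * _) /c /s !mulr_suml -big_split/= mulr_sumr.
    apply: eq_bigr => k _; rewrite !mulr_sumr -big_split/= mulr_sumr.
    by apply: eq_bigr => l _; rewrite (mulrBl t (gam k)) cosB; ring.
  apply: (@is_derive_sum_ord n (fun k t => \sum_(l < n)
    x k * x l * window_primitive S (gam k - gam l) t)
    (fun k => \sum_(l < n) x k * x l *
      ((S ^+ 2 - t ^+ 2) * cos ((gam k - gam l) * t)))) => k.
  apply: (@is_derive_sum_ord n (fun l t =>
    x k * x l * window_primitive S (gam k - gam l) t)
    (fun l => x k * x l *
      ((S ^+ 2 - t ^+ 2) * cos ((gam k - gam l) * t)))) => l.
  apply: is_derive_eq (is_derive_mul (is_derive_const (x k * x l) t)
    (is_derive_window_primitive S (gam k - gam l) t)) _.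
  by rewrite mul0r add0r.
have cc : continuous c by exact: continuous_cos_sum.
have cs : continuous s by exact: continuous_sin_sum.
have cq : continuous q.
  by move=> t; apply: cvgD; apply: cvgM; (exact: cc || exact: cs).
have cw : continuous (fun t => (S ^+ 2 - t ^+ 2) * q t).
  move=> t; apply: cvgM; last exact: cq.
  by apply: cvgB; [exact: cvg_cst|apply: cvgM; exact: cvg_id].
have wq0 t : 0 <= t <= S -> 0 <= (S ^+ 2 - t ^+ 2) * q t.
  move=> /andP[t0 tS]; rewrite mulr_ge0// subr_ge0 ler_pXn2r ?nnegrE//.
  exact: le_trans tS.
have mw A : measurable A ->
    measurable_fun A (fun t => ((S ^+ 2 - t ^+ 2) * q t)%:E).
  move=> mA; apply/measurable_EFinP; apply: measurable_funTS.
  exact: continuous_measurable_fun.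
have QS : (\int[mu]_(t in `[0%R, S]) ((S ^+ 2 - t ^+ 2) * q t)%:E =
    (Q S)%:E)%E.
  rewrite (integral_is_derive S0 DQ cw); congr EFin.
  rewrite {2}/Q big1 ?subr0// => k _; rewrite big1// => l _.
  by rewrite window_primitive0 mulr0.
have QC : Q S <= C * \sum_(k < n) x k ^+ 2 by exact: sum_window_le.
apply: (@le_trans _ _ (\int[mu]_(t in `[0%R, S])
  ((3 * T ^+ 2)^-1%:E * ((S ^+ 2 - t ^+ 2) * q t)%:E))%E); last first.
  rewrite ge0_integralZl_EFin//.
  - rewrite QS -EFinM lee_fin [C / _]mulrC -mulrA ler_wpM2l//.
    by rewrite invr_ge0 ltW.
  - exact: mw.
  - by rewrite invr_ge0 ltW.
apply: (@le_trans _ _ (\int[mu]_(t in `[0%R, T])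
  ((3 * T ^+ 2)^-1%:E * ((S ^+ 2 - t ^+ 2) * q t)%:E))%E).
  apply: ge0_le_integral => //.
  - by move=> t _; rewrite lee_fin; exact: q0.
  - apply/measurable_EFinP; apply: measurable_funTS.
    exact: continuous_measurable_fun cq.
  - by apply: measurable_funeM; exact: mw.
  - move=> t /=; rewrite in_itv/= => /andP[t0 tT].
    rewrite -EFinM lee_fin -/(c t) -/(s t) -/(q t).
    rewrite mulrA ler_peMl// ler_pdivlMl// mulr1 /S.
    have : t ^+ 2 <= T ^+ 2 by rewrite ler_pXn2r ?nnegrE// ltW.
    lra.
apply: ge0_subset_integral => //.
- by apply: measurable_funeM; exact: mw.
- move=> t /=; rewrite in_itv/= => tS; rewrite mule_ge0// lee_fin ?wq0//.
  by rewrite invr_ge0 ltW.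
- move=> t /=; rewrite !in_itv/= => /andP[-> tT]/=.
  by rewrite (le_trans tT)// /S ler_peMl ?(ltW T0)// ler1n.
Qed.

End ingham.

Section ingham_series.
Variable R : realType.
Notation mu := (@lebesgue_measure R).

Definition trig_series (gam X Y : nat -> R) (t : R) : R :=
  limn (series (fun k => X k * cos (gam k * t) + Y k * sin (gam k * t))).

Lemma trig_term_le (gam X Y M : nat -> R) t k : `|X k| + `|Y k| <= M k ->
  `|X k * cos (gam k * t) + Y k * sin (gam k * t)| <= M k.
Proof.
apply: le_trans; rewrite (le_trans (ler_normD _ _))// !normrM.
by rewrite lerD// ler_piMr// ler_norml ?cos_geN1 ?cos_le1 ?sin_geN1 ?sin_le1.
Qed.

Lemma trig_series_continuous (gam X Y M : nat -> R) :
  (forall k, `|X k| + `|Y k| <= M k) -> cvgn (series M) ->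
  continuous (trig_series gam X Y).
Proof.
move=> XYM cM t.
apply: (@cvg_dominated_series R _ _ (fun k t => X k * cos (gam k * t) +
  Y k * sin (gam k * t)) _ M) => //.
- move=> k; apply: cvgD; apply: cvgMr.
    exact: is_derive_continuous (is_derive_cosM _ _).
  exact: is_derive_continuous (is_derive_sinM _ _).
- by move=> k; exact: trig_term_le.
- by near=> y => k; exact: trig_term_le.
Unshelve. all: by end_near. Qed.

(** If h is the sum of the series and h_n a partial sum, h^2 <= 2 h_n^2 + 2 tau_n^2
with tau_n, the tail of the majorant, uniform in t; let n tend to infinity. *)
Lemma ingham_series (gam : nat -> R) (delta T : R) : 0 < delta -> 0 < T ->
  (forall i, delta <= gam i.+1 - gam i) ->
  exists2 C : R, 0 < C & forall (X Y M : nat -> R) (N : R),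
  (forall k, `|X k| + `|Y k| <= M k) -> cvgn (series M) ->
  (forall n, \sum_(k < n) (X k ^+ 2 + Y k ^+ 2) <= N) ->
  (\int[mu]_(t in `[0%R, T]) (trig_series gam X Y t ^+ 2)%:E <= (C * N)%:E)%E.
Proof.
move=> d0 T0 H; have [C C0 HC] := ingham_upper d0 T0 H.
exists (4 * C); first by rewrite mulr_gt0.
move=> X Y M N XYM cM HN.
pose tau n := limn (series M) - series M n.
pose q (x : nat -> R) n t := (\sum_(k < n) x k * cos (gam k * t)) ^+ 2 +
     (\sum_(k < n) x k * sin (gam k * t)) ^+ 2.
have q0 x n t : 0 <= q x n t by rewrite addr_ge0 ?sqr_ge0.
have cq x n : continuous (q x n).
  move=> t; apply: cvgD; apply: cvgM; exact: continuous_cos_sum || exact: continuous_sin_sum.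
have mq x n : measurable_fun (`[0, T] : set R) (fun t => (q x n t)%:E).
  by apply/measurable_EFinP; apply: measurable_funTS; exact: continuous_measurable_fun.
have bound n : (\int[mu]_(t in `[0%R, T]) (trig_series gam X Y t ^+ 2)%:E <=
    (4 * C * N + 2 * T * tau n ^+ 2)%:E)%E.
  apply: (@le_trans _ _ (\int[mu]_(t in `[0%R, T])
    (4%:E * ((q X n t)%:E + (q Y n t)%:E) + (2 * tau n ^+ 2)%:E))%E).
    apply: ge0_le_integral => //.
    - by move=> t _; rewrite lee_fin sqr_ge0.
    - apply/measurable_EFinP; apply: measurable_funTS.
      apply: continuous_measurable_fun => t.
      by apply: cvgM; exact: trig_series_continuous XYM cM t.
    - apply: emeasurable_funD => //; apply: measurable_funeM.
      by apply: emeasurable_funD; exact: mq.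
    - move=> t _; rewrite -(EFinD (q X n t)) -(EFinM 4) -(EFinD (4 * _)) lee_fin.
      have tail : `|trig_series gam X Y t - \sum_(k < n) (X k * cos (gam k * t) +
          Y k * sin (gam k * t))| <= tau n.
        rewrite -(big_mkord xpredT (fun k => X k * cos (gam k * t) +
          Y k * sin (gam k * t))).
        by apply: dominated_series_tail => // k; exact: trig_term_le.
      have {}tail : (trig_series gam X Y t - \sum_(k < n) (X k * cos (gam k * t) +
          Y k * sin (gam k * t))) ^+ 2 <= tau n ^+ 2.
        rewrite -(real_normK (num_real (_ - _))) ler_pXn2r ?nnegrE//.
        exact: le_trans tail.
      move: tail; rewrite big_split/= /q.
      move: (trig_series _ _ _ _) (\sum_(_ < _) X _ * cos _)
        (\sum_(_ < _) X _ * sin _) (\sum_(_ < _) Y _ * cos _)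
        (\sum_(_ < _) Y _ * sin _) => h cX sX cY sY tail.
      have h1 : 0 <= (h - 2 * (cX + sY)) ^+ 2 by exact: sqr_ge0.
      have h2 : 0 <= (cX - sY) ^+ 2 by exact: sqr_ge0.
      have h3 : 0 <= sX ^+ 2 by exact: sqr_ge0.
      have h4 : 0 <= cY ^+ 2 by exact: sqr_ge0.
      nra.
  rewrite ge0_integralD//; last 3 first.
  - by move=> t _; rewrite mule_ge0// adde_ge0// lee_fin.
  - by apply: measurable_funeM; apply: emeasurable_funD; exact: mq.
  - by move=> t _; rewrite lee_fin mulr_ge0 ?sqr_ge0.
  rewrite ge0_integralZl_EFin//; last 2 first.
  - by move=> t _; rewrite adde_ge0// lee_fin.
  - by apply: emeasurable_funD; exact: mq.
  rewrite ge0_integralD//; last 4 first.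
  - by move=> t _; rewrite lee_fin.
  - exact: mq.
  - by move=> t _; rewrite lee_fin.
  - exact: mq.
  rewrite integral_cst//= lebesgue_measure_itv/= lte_fin T0.
  rewrite (EFinD (4 * C * N)); apply: leeD.
    apply: (@le_trans _ _ (4%:E * ((C * \sum_(k < n) X k ^+ 2)%:E +
      (C * \sum_(k < n) Y k ^+ 2)%:E))%E).
      by rewrite lee_wpmul2l ?lee_fin// leeD//; exact: HC.
    rewrite -EFinD -EFinM lee_fin -mulrDr -big_split/= mulrA.
    by apply: ler_wpM2l (HN n); rewrite mulr_ge0// ltW.
  by rewrite -EFinD -EFinM oppr0 addr0 lee_fin; lra.
have L : (4 * C * N + 2 * T * tau n ^+ 2)%:E @[n --> \oo] --> (4 * C * N)%:E.
  apply: cvg_EFin; first by near=> n.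
  rewrite -[X in _ --> X]addr0; apply: cvgD; first exact: cvg_cst.
  rewrite -[X in _ --> X](mulr0 (2 * T)); apply: cvgMr.
  rewrite -[X in _ --> X](mulr0 0).
  by apply: cvgM; exact: series_tail_cvg0.
apply: (cvge_to_ge L); near=> n; exact: bound.
Unshelve. all: by end_near. Qed.

End ingham_series.

(** * Zeros, frequencies and weights *)

Section spectral_estimates.
Variable R : realType.
Variables (alpha beta mu : R) (j : nat -> R).
Hypothesis halpha2 : alpha < 2.
Hypothesis hj : bessel_zeros (nu alpha beta mu) j.

Local Notation kappa := (kappa alpha).
Local Notation nu := (nu alpha beta mu).
Local Notation sigma := (sigma alpha beta).
Local Notation lambda := (lambda alpha j).
Local Notation gamma := (gamma alpha j).
Local Notation Phi := (Phi alpha beta mu j).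

Lemma kappa_gt0 : 0 < kappa.
Proof. by rewrite divr_gt0// subr_gt0. Qed.

Lemma nu_ge0 : 0 <= nu.
Proof. by rewrite divr_ge0 ?sqrtr_ge0// mulr_ge0// ltW// kappa_gt0. Qed.

Lemma kappa_nu : kappa * nu = Num.sqrt (Delta alpha beta mu) / 2.
Proof. by rewrite /Defs.nu; field; rewrite gt_eqF// kappa_gt0. Qed.

Let ode := bessel_ode_nbessel nu_ge0.

Let e_ge0 : 0 <= 2 * nu + 1.
Proof. exact: addr_ge0 (mulr_ge0 (ler0n R 2) nu_ge0) ler01. Qed.

Lemma bessel_zeros_gt0 k : 0 < j k.
Proof.
by have [_ /(_ (j k))[_ /(_ (ex_intro _ k erefl))[]]] := hj.
Qed.

Lemma nbessel_zero k : nbessel nu (j k) = 0.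
Proof.
apply: besselJ_eq0; [exact: nu_ge0|exact: bessel_zeros_gt0|].
by have [_ /(_ (j k))[_ /(_ (ex_intro _ k erefl))[]]] := hj.
Qed.

Lemma bessel_zeros_gap k : 1 <= j k.+1 - j k.
Proof.
have [/(_ k k.+1 (ltnSn k)) jj _] := hj.
by apply: (bessel_ode_gap ode e_ge0) => //; [exact: bessel_zeros_gt0|exact: nbessel_zero..].
Qed.

Lemma bessel_zeros_ge k : j 0%N + k%:R <= j k.
Proof.
elim: k => [|k IH]; first by rewrite addr0.
by have := bessel_zeros_gap k; rewrite -natr1; lra.
Qed.

Lemma nbessel'_zero_neq0 k : nbessel' nu (j k) != 0.
Proof.
have := energy_gt0 ode e_ge0 (bessel_zeros_gt0 k); rewrite nbessel_zero expr0n/= addr0.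
by move=> h; apply: contraTneq h => ->; rewrite expr0n/= ltxx.
Qed.

(** The limit at 0 of x^(- sigma - kappa nu) Phi_k x. *)
Definition weight k : R := Num.sqrt (2 * kappa) / `|nbessel' nu (j k)|.

Lemma weight_ge0 k : 0 <= weight k.
Proof. by rewrite divr_ge0 ?sqrtr_ge0. Qed.

Lemma gammaE k : gamma k = kappa * j k.
Proof.
rewrite /Defs.gamma /Defs.lambda -exprMn sqrtr_sqr ger0_norm//.
by rewrite mulr_ge0 ?ltW ?kappa_gt0 ?bessel_zeros_gt0.
Qed.

Lemma gamma_gt0 k : 0 < gamma k.
Proof. by rewrite gammaE mulr_gt0 ?kappa_gt0 ?bessel_zeros_gt0. Qed.

Lemma lambdaE k : lambda k = gamma k ^+ 2.
Proof. by rewrite gammaE exprMn. Qed.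

Lemma lambda_powR k s : lambda k `^ s = gamma k `^ (2 * s).
Proof. by rewrite lambdaE powRrM powR_mulrn// ltW// gamma_gt0. Qed.

(** Both sides scale like j_k^(2 nu + 1), by the lower bound on the derivative of
nbessel at its zeros. *)
Lemma weight_le : exists2 C, 0 < C &
  forall k, weight k ^+ 2 <= C * lambda k `^ (nu + 1 / 2).
Proof.
have [c c0 H] := bessel_ode_derive_ge ode e_ge0 (bessel_zeros_gt0 0) (nbessel_zero 0).
have k0 := kappa_gt0.
have K0 : 0 < kappa `^ (2 * nu + 1) by rewrite powR_gt0.
exists (2 * kappa / (c * kappa `^ (2 * nu + 1))).
  by apply: divr_gt0; apply: mulr_gt0.
move=> k; have jk : j 0%N <= j k by have := bessel_zeros_ge k; have := ler0n R k; lra.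
have {}H := H _ jk (nbessel_zero k).
have d0 : 0 < nbessel' nu (j k) ^+ 2.
  by rewrite lt_neqAle sqr_ge0 eq_sym sqrf_eq0 nbessel'_zero_neq0.
rewrite lambda_powR (_ : 2 * (nu + 1 / 2) = 2 * nu + 1); last by field.
rewrite gammaE powRM ?(ltW k0) ?(ltW (bessel_zeros_gt0 k))//.
have k2 : 0 <= 2 * kappa by exact: mulr_ge0 (ler0n R 2) (ltW k0).
rewrite exprMn exprVn real_normK ?num_real// sqr_sqrtr//.
rewrite ler_pdivrMr//.
rewrite [leRHS](_ : _ = 2 * kappa * (j k `^ (2 * nu + 1) *
  nbessel' nu (j k) ^+ 2 / c)); last by field; rewrite !gt_eqF.
apply: ler_peMr => //.
by rewrite ler_pdivlMr// mul1r.
Qed.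

Definition phi_exponent : R := sigma + kappa * nu.
Local Notation p := phi_exponent.

Lemma PhiE k x : 0 < x ->
  Phi k x = weight k * (x `^ p * nbessel nu (j k * x `^ kappa)).
Proof.
move=> x0; have j0 := bessel_zeros_gt0 k.
have K0 := besselJ_scale_gt0 nu_ge0.
have xk : 0 < x `^ kappa by rewrite powR_gt0.
have jx0 : 0 < j k * x `^ kappa by rewrite mulr_gt0.
have Kj : 0 < besselJ_scale nu * j k `^ nu by rewrite mulr_gt0// powR_gt0.
have n0 := nu_ge0.
rewrite /Defs.Phi besselJ_derive1 ?nbessel_zero// besselJE//.
rewrite powRM ?(ltW j0) ?(ltW xk)// -powRrM.
rewrite /p powRD ?(gt_eqF x0) ?implybT// normrM (gtr0_norm Kj).
rewrite /weight; field.
by rewrite normr_eq0 nbessel'_zero_neq0 !gt_eqF// powR_gt0.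
Qed.

(** The sum of the a_k Phi_k, divided by x^phi_exponent. *)
Definition bessel_sum (a : nat -> R) x : R :=
  limn (series (fun k => a k * weight k * nbessel nu (j k * x `^ kappa))).

Lemma bessel_term_le (a : nat -> R) (M : nat -> R) x k :
  `|a k| * weight k <= M k ->
  `|a k * weight k * nbessel nu (j k * x `^ kappa)| <= M k.
Proof.
apply: le_trans; rewrite normrM [`|a k * _|]normrM (ger0_norm (weight_ge0 k)).
apply: ler_piMr; first exact: mulr_ge0 (normr_ge0 _) (weight_ge0 k).
apply: bessel_ode_le1 ode e_ge0 _.
by rewrite mulr_ge0 ?powR_ge0 ?ltW ?bessel_zeros_gt0.
Qed.

Section majorized.
Variables (a M : nat -> R).
Hypothesis aM : forall k, `|a k| * weight k <= M k.
Hypothesis cM : cvgn (series M).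

Lemma bessel_sum_tail x n :
  `|bessel_sum a x - \sum_(k < n) a k * weight k * nbessel nu (j k * x `^ kappa)|
  <= limn (series M) - series M n.
Proof.
rewrite -(big_mkord xpredT (fun k =>
  a k * weight k * nbessel nu (j k * x `^ kappa))).
by apply: dominated_series_tail => // k; exact: bessel_term_le.
Qed.

Let cg z : {for z, continuous (nbessel nu)}.
Proof. by have [Dg _ _ _ _] := ode; exact: is_derive_continuous (Dg z). Qed.

Lemma bessel_sum_continuous x : 0 < x -> {for x, continuous (bessel_sum a)}.
Proof.
move=> x0; apply: (@cvg_dominated_series R _ _ (fun k x =>
  a k * weight k * nbessel nu (j k * x `^ kappa)) _ M) => //.
- move=> k; apply: cvgMr.
  apply: (@continuous_comp _ _ _ (fun x => j k * x `^ kappa) (nbessel nu)); last exact: cg.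
  apply: cvgMr.
  exact: is_derive_continuous (is_derive_powR kappa x0).
- by move=> k; exact: bessel_term_le.
- by near=> y => k; exact: bessel_term_le.
Unshelve. all: by end_near. Qed.

Lemma bessel_sum_cvg0 :
  bessel_sum a x @[x --> 0^'+] --> limn (series (fun k => a k * weight k)).
Proof.
have [_ _ _ g0 _] := ode.
apply: (@cvg_dominated_series R _ _ (fun k x =>
  a k * weight k * nbessel nu (j k * x `^ kappa)) _ M) => //.
- move=> k; rewrite -[X in _ --> X]mulr1; apply: cvgMr; rewrite -g0.
  have jx : j k * x `^ kappa @[x --> 0^'+] --> (0 : R).
    rewrite -[X in _ --> X](mulr0 (j k)); apply: cvgMr; apply: powR_cvg0; exact: kappa_gt0.
  apply: (@cvg_comp _ _ _ (fun x => j k * x `^ kappa) (nbessel nu) _ _ _ jx).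
  exact: cg.
- by move=> k; rewrite normrM (ger0_norm (weight_ge0 k)).
- by near=> y => k; exact: bessel_term_le.
Unshelve. all: by end_near. Qed.

End majorized.

Lemma Phi_continuous k x : 0 < x -> {for x, continuous (Phi k)}.
Proof.
move=> x0.
have [Dg _ _ _ _] := ode.
have H : {for x, continuous
    (fun x => weight k * (x `^ p * nbessel nu (j k * x `^ kappa)))}.
  apply: cvgMr; apply: cvgM.
    exact: is_derive_continuous (is_derive_powR p x0).
  apply: (@continuous_comp _ _ _ (fun x => j k * x `^ kappa) (nbessel nu)).
    by apply: cvgMr; exact: is_derive_continuous (is_derive_powR kappa x0).
  exact: is_derive_continuous (Dg _).
suff : Phi k y @[y --> x] --> Phi k x by [].
rewrite [X in _ --> X]PhiE//; apply: cvg_trans H; apply: near_eq_cvg.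
by near=> y; rewrite PhiE//; near: y; exact: lt_nbhsr.
Unshelve. all: by end_near. Qed.

End spectral_estimates.

(** * The continuous representative and its limit at 0 *)

Section representative.
Variable R : realType.
Variables (alpha beta mu : R) (j : nat -> R).
Hypothesis halpha2 : alpha < 2.
Hypothesis hj : bessel_zeros (nu alpha beta mu) j.
Local Open Scope complex_scope.

Local Notation kappa := (kappa alpha).
Local Notation nu := (nu alpha beta mu).
Local Notation sigma := (sigma alpha beta).
Local Notation Phi := (Phi alpha beta mu j).
Local Notation rep := (is_continuous_rep alpha beta mu j).
Local Notation p := (phi_exponent alpha beta mu).
Local Notation weight := (weight alpha beta mu j).
Local Notation bessel_sum := (bessel_sum alpha beta mu j).
Local Notation leb := (@lebesgue_measure R).

Definition residual (a : nat -> R[i]) (f : R -> R[i]) n x : R :=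
  normc (f x - \sum_(k < n) a k * (Phi k x)%:C) ^+ 2 * x `^ beta.

Lemma residual_ge0 a f n x : 0 <= residual a f n x.
Proof. by rewrite mulr_ge0 ?sqr_ge0 ?powR_ge0. Qed.

Lemma residualE a f n x : residual a f n x =
  ((complex.Re (f x) - \sum_(k < n) complex.Re (a k) * Phi k x) ^+ 2 +
   (complex.Im (f x) - \sum_(k < n) complex.Im (a k) * Phi k x) ^+ 2) * x `^ beta.
Proof.
rewrite /residual normc_sqr -(Re_sum_real n a (Phi ^~ x)).
rewrite -(Im_sum_real n a (Phi ^~ x)).
by case: (f x) (\sum_(_ < _) _) => ? ? [].
Qed.

Lemma continuous_real_sum (b : nat -> R) n x : 0 < x ->
  {for x, continuous (fun x => \sum_(k < n) b k * Phi k x)}.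
Proof.
move=> x0; apply: (@cvg_sum_ord _ _ _ _ n (fun k x => b k * Phi k x)
  (fun k => b k * Phi k x)) => k.
by apply: cvgMr; exact: Phi_continuous.
Qed.

Lemma residual_continuous a (f : R -> R[i]) n :
  (forall x, 0 < x < 1 -> {for x, continuous (f : R -> R[i]^o)}) ->
  {in `]0, 1[, continuous (residual a f n)}.
Proof.
move=> cf x; rewrite in_itv/= => x01; have /andP[x0 x1] := x01.
rewrite (_ : residual a f n = fun x =>
  ((complex.Re (f x) - \sum_(k < n) complex.Re (a k) * Phi k x) ^+ 2 +
   (complex.Im (f x) - \sum_(k < n) complex.Im (a k) * Phi k x) ^+ 2) *
   x `^ beta); last by apply/funext => y; exact: residualE.
have cR : {for x, continuous
    (fun x => complex.Re (f x) - \sum_(k < n) complex.Re (a k) * Phi k x)}.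
  apply: cvgB; first exact: cvg_Re (cf x x01).
  exact: (@continuous_real_sum (fun k => complex.Re (a k))).
have cI : {for x, continuous
    (fun x => complex.Im (f x) - \sum_(k < n) complex.Im (a k) * Phi k x)}.
  apply: cvgB; first exact: cvg_Im (cf x x01).
  exact: (@continuous_real_sum (fun k => complex.Im (a k))).
apply: cvgM; last exact: is_derive_continuous (is_derive_powR beta x0).
by apply: cvgD; apply: cvgM; (exact: cR || exact: cI).
Qed.

Lemma residual_measurable a (f : R -> R[i]) n :
  (forall x, 0 < x < 1 -> {for x, continuous (f : R -> R[i]^o)}) ->
  measurable_fun (`]0, 1[ : set R) (fun x => (residual a f n x)%:E).
Proof.
move=> cf; apply/measurable_EFinP; apply: open_continuous_measurable_fun => // x.
by rewrite inE; exact: residual_continuous.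
Qed.

(** For every partial sum S one has |f - g|^2 <= 2 |f - S|^2 + 2 |g - S|^2, so the
integral of |f - g|^2 x^beta is 0, and this integrand is continuous. *)
Lemma continuous_rep_unique a (f g : R -> R[i]) : rep a f -> rep a g ->
  forall x, 0 < x < 1 -> f x = g x.
Proof.
move=> [cf If] [cg Ig].
pose h x : R[i] := f x - g x.
have ch x : 0 < x < 1 -> {for x, continuous (h : R -> R[i]^o)}.
  by move=> x01; apply: cvgB; [exact: cf|exact: cg].
pose D := residual (fun=> 0) h 0.
have DE x : D x = normc (h x) ^+ 2 * x `^ beta.
  by rewrite /D /residual big_ord0 subr0.
have cD : {in `]0, 1[, continuous D} by exact: residual_continuous ch.
have ID : (\int[leb]_(x in `]0%R, 1%R[) (D x)%:E = 0)%E.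
  apply/eqP; rewrite eq_le; apply/andP; split; last first.
    by apply: integral_ge0 => x _; rewrite lee_fin residual_ge0.
  have lim0 : (2%:E * (\int[leb]_(x in `]0%R, 1%R[) (residual a f n x)%:E +
    \int[leb]_(x in `]0%R, 1%R[) (residual a g n x)%:E))%E @[n --> \oo] --> 0%E.
    rewrite -[X in _ --> X](mule0 2%:E) -[X in (_ * X)%E](adde0 0%E).
    by apply: cvgeMl => //; apply: cvgeD.
  apply: (cvge_to_ge lim0); near=> n.
  have mf := residual_measurable a n cf.
  have mg := residual_measurable a n cg.
  rewrite -ge0_integralD//; last 2 first.
  - by move=> x _; rewrite lee_fin residual_ge0.
  - by move=> x _; rewrite lee_fin residual_ge0.
  rewrite -ge0_integralZl_EFin//; last 2 first.
  - by move=> x _; rewrite adde_ge0// lee_fin residual_ge0.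
  - exact: emeasurable_funD mf mg.
  apply: ge0_le_integral => //.
  - by move=> x _; rewrite lee_fin residual_ge0.
  - exact: residual_measurable ch.
  - apply: measurable_funeM.
    exact: emeasurable_funD mf mg.
  - move=> x _; rewrite -EFinD -EFinM lee_fin DE !residualE -mulrDl mulrA.
    rewrite ler_wpM2r ?powR_ge0// normc_sqr /h.
    case: (f x) (g x) => a1 a2 [b1 b2] /=.
    move: (\sum_(_ < _) _) (\sum_(_ < _) _) => s2 s1.
    have : 0 <= (a1 + b1 - 2 * s1) ^+ 2 + (a2 + b2 - 2 * s2) ^+ 2.
      by rewrite addr_ge0 ?sqr_ge0.
    lra.
move=> x x01; have /andP[x0 _] := x01.
have := integral_continuous_eq0 cD (fun x _ => residual_ge0 _ _ _ x) ID x01.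
rewrite DE => /eqP; rewrite mulf_eq0 sqrf_eq0 powR_eq0 (gt_eqF x0) orbF.
by move=> /eqP/eq0_normc/eqP; rewrite subr_eq0 => /eqP.
Unshelve. all: by end_near. Qed.

Definition bessel_rep (a : nat -> R[i]) x : R[i] :=
  (x `^ p * bessel_sum (fun k => complex.Re (a k)) x) +i*
  (x `^ p * bessel_sum (fun k => complex.Im (a k)) x).

Section majorized.
Variables (a : nat -> R[i]) (M : nat -> R).
Hypothesis aM : forall k, normc (a k) * weight k <= M k.
Hypothesis cM : cvgn (series M).

Let aReM k : `|complex.Re (a k)| * weight k <= M k.
Proof. exact: le_trans (ler_wpM2r (weight_ge0 _ _ _ _ _) (normRe_le _)) (aM k). Qed.

Let aImM k : `|complex.Im (a k)| * weight k <= M k.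
Proof. exact: le_trans (ler_wpM2r (weight_ge0 _ _ _ _ _) (normIm_le _)) (aM k). Qed.

Lemma residual_bessel_rep_le n x : 0 < x < 1 ->
  residual a (bessel_rep a) n x <=
  2 * (limn (series M) - series M n) ^+ 2 * x `^ (2 * p + beta).
Proof.
move=> /andP[x0 x1]; rewrite residualE/=.
have E (b : nat -> R) : x `^ p * bessel_sum b x - \sum_(k < n) b k * Phi k x =
    x `^ p * (bessel_sum b x -
      \sum_(k < n) b k * weight k * nbessel nu (j k * x `^ kappa)).
  rewrite mulrBr; congr (_ - _); rewrite mulr_sumr; apply: eq_bigr => k _.
  by rewrite PhiE//; ring.
rewrite !E !exprMn -mulrDr mulrAC [leRHS]mulrC.
have -> : x `^ (2 * p + beta) = (x `^ p) ^+ 2 * x `^ beta.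
  rewrite (@powRD _ x (2 * p)) ?(gt_eqF x0) ?implybT//; congr (_ * _).
  by rewrite mulrC powRrM powR_mulrn// powR_ge0.
rewrite ler_wpM2l ?mulr_ge0 ?sqr_ge0 ?powR_ge0//.
have T b : (forall k, `|b k| * weight k <= M k) ->
    (bessel_sum b x - \sum_(k < n) b k * weight k * nbessel nu (j k * x `^ kappa)) ^+ 2
    <= (limn (series M) - series M n) ^+ 2.
  move=> bM; rewrite -(real_normK (num_real (_ - _))).
  have H := bessel_sum_tail halpha2 hj bM cM x n.
  by rewrite ler_pXn2r ?nnegrE// (le_trans _ H).
by have := T _ aReM; have := T _ aImM; lra.
Qed.

Lemma bessel_rep_continuous x : 0 < x ->
  {for x, continuous (bessel_rep a : R -> R[i]^o)}.
Proof.
move=> x0; have cp := is_derive_continuous (is_derive_powR p x0).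
apply: cvg_complex; apply: cvgM => //.
- exact: (bessel_sum_continuous halpha2 hj aReM cM).
- exact: (bessel_sum_continuous halpha2 hj aImM cM).
Qed.

Lemma is_continuous_rep_bessel_rep : rep a (bessel_rep a).
Proof.
have c01 x : 0 < x < 1 -> {for x, continuous (bessel_rep a : R -> R[i]^o)}.
  by move=> /andP[x0 _]; exact: bessel_rep_continuous.
split=> //.
(* 2 p + beta = 1 - alpha + 2 kappa nu, and alpha < 2 *)
have q1 : -1 < 2 * p + beta.
  rewrite /phi_exponent /Defs.sigma.
  have := mulr_ge0 (ltW (kappa_gt0 halpha2)) (nu_ge0 beta mu halpha2).
  by have := halpha2; move: (kappa * nu) => z; lra.
have Ifin := integral_powR01 q1.
set I := (\int[_]_(x in _) _)%E in Ifin.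
have I0 : (0 <= I)%E by apply: integral_ge0 => x _; rewrite lee_fin powR_ge0.
have If : I \is a fin_num by rewrite ge0_fin_numE.
pose tau n := 2 * (limn (series M) - series M n) ^+ 2.
apply: (@squeeze_cvge _ _ _ _ (fun=> 0%E) _ (fun n => (tau n * fine I)%:E)).
- near=> n; apply/andP; split.
    by apply: integral_ge0 => x _; rewrite lee_fin residual_ge0.
  rewrite EFinM fineK// /I -ge0_integralZl_EFin//; last 3 first.
  + by move=> x _; rewrite lee_fin powR_ge0.
  + apply/measurable_EFinP; apply: measurable_funTS; exact: measurable_powR.
  + by rewrite mulr_ge0 ?sqr_ge0.
  apply: ge0_le_integral => //.
  + by move=> x _; rewrite lee_fin residual_ge0.
  + exact: residual_measurable.
  + apply: measurable_funeM; apply/measurable_EFinP; apply: measurable_funTS.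
    exact: measurable_powR.
  + move=> x /=; rewrite in_itv/= => x01; rewrite -EFinM lee_fin.
    exact: residual_bessel_rep_le.
- exact: cvg_cst.
- apply: cvg_EFin; first by near=> n.
  rewrite -[X in _ --> X](mul0r (fine I)); apply: cvgMl.
  rewrite -[X in _ --> X](mulr0 2) -[X in _ * X](mulr0 0).
  by apply: cvgMr; apply: cvgM; exact: series_tail_cvg0.
Unshelve. all: by end_near. Qed.

Lemma continuous_repE x : 0 < x < 1 ->
  continuous_rep alpha beta mu j a x = bessel_rep a x.
Proof.
apply: continuous_rep_unique; last exact: is_continuous_rep_bessel_rep.
rewrite /continuous_rep; case: xgetP => [f -> //|].
by move=> /(_ _ is_continuous_rep_bessel_rep).
Qed.

Lemma continuous_rep_lim : lim (((x `^ (- p))%:C * continuous_rep alpha beta mu j a x : R[i]^o)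
    @[x --> 0^'+]) =
  limn (series (fun k => complex.Re (a k) * weight k)) +i*
  limn (series (fun k => complex.Im (a k) * weight k)).
Proof.
apply: cvg_lim; first exact: norm_hausdorff.
have H : (fun x => (bessel_sum (fun k => complex.Re (a k)) x +i*
    bessel_sum (fun k => complex.Im (a k)) x : R[i]^o)) @ 0^'+ -->
    (limn (series (fun k => complex.Re (a k) * weight k)) +i*
     limn (series (fun k => complex.Im (a k) * weight k)) : R[i]^o).
  apply: cvg_complex.
  - exact: (bessel_sum_cvg0 halpha2 hj aReM cM).
  - exact: (bessel_sum_cvg0 halpha2 hj aImM cM).
apply: cvg_trans H; apply: near_eq_cvg; near=> x.
have x0 : 0 < x by near: x; exact: nbhs_right_gt.
have x1 : x < 1 by near: x; exact: nbhs_right_lt.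
rewrite continuous_repE ?x0// /bessel_rep powRN.
have xp : x `^ p != 0 by rewrite gt_eqF// powR_gt0.
by apply/eqP; rewrite eq_complex/= !mul0r subr0 addr0 !mulKf// !eqxx.
Unshelve. all: by end_near. Qed.

End majorized.

Definition obs_factor : R :=
  if nu == 0 then 1 else Num.sqrt (Delta alpha beta mu).

Lemma obsE (w : state R) (M : nat -> R) :
  (forall k, normc (w.1 k) * weight k <= M k) -> cvgn (series M) ->
  normc (obs alpha beta mu j w) ^+ 2 = obs_factor ^+ 2 *
    (limn (series (fun k => complex.Re (w.1 k) * weight k)) ^+ 2 +
     limn (series (fun k => complex.Im (w.1 k) * weight k)) ^+ 2).
Proof.
move=> aM cM; rewrite /obs /obs_factor; have L := continuous_rep_lim aM cM.
case: eqP => nu0.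
  rewrite expr1n mul1r.
  rewrite /phi_exponent nu0 mulr0 addr0 in L.
  by rewrite L normc_sqr.
have E : - sigma - Num.sqrt (Delta alpha beta mu) / 2 = - p.
  by rewrite /phi_exponent kappa_nu// opprD.
by rewrite E L normcM exprMn !normc_sqr/= expr0n/= addr0.
Qed.

End representative.

(** * Coefficients of the observed series *)

Section state_estimates.
Variable R : realType.
Variables (alpha beta mu : R) (j : nat -> R).
Hypothesis halpha2 : alpha < 2.
Hypothesis hj : bessel_zeros (nu alpha beta mu) j.
Local Open Scope complex_scope.

Local Notation kappa := (kappa alpha).
Local Notation nu := (nu alpha beta mu).
Local Notation lambda := (lambda alpha j).
Local Notation gamma := (gamma alpha j).
Local Notation weight := (weight alpha beta mu j).

Let g0 k : 0 < gamma k. Proof. exact: gamma_gt0 halpha2 hj k. Qed.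

Let l0 k : 0 < lambda k.
Proof. by rewrite (lambdaE halpha2 hj) exprn_gt0. Qed.

Lemma gamma_gap k : kappa <= gamma k.+1 - gamma k.
Proof.
have k0 := kappa_gt0 halpha2.
rewrite !(gammaE halpha2 hj) -mulrBr ler_peMr ?(ltW k0)//.
exact: bessel_zeros_gap halpha2 hj k.
Qed.

Lemma gamma_inv2_cvg : cvgn (series (fun k => (gamma k)^-1 ^+ 2)).
Proof.
have k0 := kappa_gt0 halpha2.
apply: (@bounded_series_cvg _ _ ((gamma 0%N)^-1 ^+ 2 + kappa^-1 ^+ 2 * 6)).
  by move=> k; exact: sqr_ge0.
move=> n; have H k : (gamma k)^-1 ^+ 2 <=
    (if k == 0%N then (gamma 0%N)^-1 ^+ 2 else 0) + kappa^-1 ^+ 2 * inv_sqdist R 0 k.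
  rewrite /inv_sqdist eq_sym; case: eqP => [<-|/eqP k1].
    by rewrite mulr0 addr0.
  have kk : 0 < k%:R :> R by rewrite ltr0n lt0n eq_sym.
  have kg : kappa * k%:R <= gamma k.
    rewrite (gammaE halpha2 hj) ler_pM2l//.
    have := bessel_zeros_ge halpha2 hj k; have := bessel_zeros_gt0 hj 0; lra.
  rewrite add0r sub0r sqrrN -exprVn -exprMn -invfM.
  rewrite ler_pXn2r ?nnegrE ?invr_ge0 ?(ltW (g0 k)) ?(ltW (mulr_gt0 k0 kk))//.
  by rewrite lef_pV2 ?posrE// mulr_gt0.
apply: le_trans (ler_sum _ (fun (i : 'I_n) _ => H i)) _.
rewrite big_split/= -mulr_sumr lerD//.
  case: n => [|n]; first by rewrite big_ord0 sqr_ge0.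
  by rewrite big_ord_recl/= big1 ?addr0.
by rewrite ler_wpM2l ?sqr_ge0// sum_inv_sqdist.
Qed.

Lemma T_group_majorized t (w : state R) k :
  normc ((T_group alpha j t w).1 k) * weight k <=
  weight k * (normc (w.1 k) + (gamma k)^-1 * normc (w.2 k)).
Proof.
have w0 : 0 <= weight k by exact: weight_ge0.
rewrite mulrC ler_wpM2l//= (le_trans (le_normcD _ _))// !normcM.
have normcR (x : R) : normc x%:C = `|x| by rewrite /= expr0n/= addr0 sqrtr_sqr.
rewrite !normcR; apply: lerD.
  by rewrite ler_piMr ?normc_ge0// ler_norml cos_geN1 cos_le1.
rewrite ler_wpM2r ?normc_ge0// normrM ger0_norm ?invr_ge0 ?(ltW (g0 k))//.
by rewrite ler_piMr ?invr_ge0 ?(ltW (g0 k))// ler_norml sin_geN1 sin_le1.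
Qed.

(** X1 has one more power of lambda_k = gamma_k^2 than the norm of X, which pays for
the convergent series of the gamma_k^(-2): for instance
2 weight_k |a_k| <= (weight_k gamma_k |a_k|)^2 + gamma_k^(-2). *)
Lemma X1_majorant_cvg (w : state R) : X1 alpha beta mu j w ->
  cvgn (series (fun k => weight k * (normc (w.1 k) + (gamma k)^-1 * normc (w.2 k)))).
Proof.
move=> [Ha Hc]; have [C C0 HC] := weight_le halpha2 hj.
pose A k := lambda k `^ (nu + 3 / 2) * normc (w.1 k) ^+ 2.
pose B k := lambda k `^ (nu + 1 / 2) * normc (w.2 k) ^+ 2.
have cA : cvgn (series A).
  by apply: nneseries_fin_cvg => // k; rewrite mulr_ge0 ?powR_ge0 ?sqr_ge0.
have cB : cvgn (series B).
  by apply: nneseries_fin_cvg => // k; rewrite mulr_ge0 ?powR_ge0 ?sqr_ge0.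
apply: (@dominated_series_cvg _ _ (C *: A + C *: B +
  (fun k => (gamma k)^-1 ^+ 2))); last first.
  apply: is_cvg_seriesD; last exact: gamma_inv2_cvg.
  by apply: is_cvg_seriesD; apply: is_cvg_seriesZ.
move=> k.
have w0 : 0 <= weight k by exact: weight_ge0.
have gV : 0 <= (gamma k)^-1 by rewrite invr_ge0 ltW.
have a0 := normc_ge0 (w.1 k); have c0 := normc_ge0 (w.2 k).
rewrite ger0_norm; last by rewrite mulr_ge0// addr_ge0// mulr_ge0.
have -> : (C *: A + C *: B + (fun k => (gamma k)^-1 ^+ 2)) k =
  C * A k + C * B k + (gamma k)^-1 ^+ 2 by [].
have wA : (weight k * gamma k * normc (w.1 k)) ^+ 2 <= C * A k.
  have -> : C * A k = C * lambda k `^ (nu + 1 / 2) * gamma k ^+ 2 * normc (w.1 k) ^+ 2.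
    rewrite /A (_ : nu + 3 / 2 = nu + 1 / 2 + 1); last by field.
    rewrite powRD ?(gt_eqF (l0 k)) ?implybT// powRr1 ?(ltW (l0 k))//.
    by rewrite -(lambdaE halpha2 hj); ring.
  rewrite exprMn [(weight k * _) ^+ 2]exprMn.
  by apply: ler_wpM2r (sqr_ge0 _) _ _ _; apply: ler_wpM2r (sqr_ge0 _) _ _ (HC k).
have wB : (weight k * normc (w.2 k)) ^+ 2 <= C * B k.
  by rewrite /B mulrA exprMn ler_wpM2r ?sqr_ge0.
have e1 : 0 <= (weight k * gamma k * normc (w.1 k) - (gamma k)^-1) ^+ 2 by exact: sqr_ge0.
have e2 : 0 <= (weight k * normc (w.2 k) - (gamma k)^-1) ^+ 2 by exact: sqr_ge0.
have E1 : weight k * gamma k * normc (w.1 k) * (gamma k)^-1 = weight k * normc (w.1 k).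
  by field; rewrite gt_eqF.
have e3 := sqr_ge0 (weight k * gamma k * normc (w.1 k)).
have e4 := sqr_ge0 (weight k * normc (w.2 k)).
move: e1 e2; rewrite !sqrrB E1 !mulr2n; lra.
Qed.

Lemma sum_weight_le C (w : state R) n : 0 <= C ->
  (forall k, weight k ^+ 2 <= C * lambda k `^ (nu + 1 / 2)) ->
  ((\sum_(k < n) weight k ^+ 2 *
    (normc (w.1 k) ^+ 2 + (gamma k)^-1 ^+ 2 * normc (w.2 k) ^+ 2))%:E <=
  C%:E * sqnormX alpha beta mu j w)%E.
Proof.
move=> C0 HC.
pose A k := lambda k `^ (nu + 1 / 2) * normc (w.1 k) ^+ 2.
pose B k := lambda k `^ (nu - 1 / 2) * normc (w.2 k) ^+ 2.
have A0 k : 0 <= A k by rewrite mulr_ge0 ?powR_ge0 ?sqr_ge0.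
have B0 k : 0 <= B k by rewrite mulr_ge0 ?powR_ge0 ?sqr_ge0.
apply: (@le_trans _ _ (C%:E * ((\sum_(k < n) A k)%:E + (\sum_(k < n) B k)%:E))%E).
  rewrite -EFinD -EFinM lee_fin -big_split/= mulr_sumr; apply: ler_sum => k _.
  rewrite /A /B (_ : nu - 1 / 2 = nu + 1 / 2 - 1); last by field.
  rewrite powRB ?(gt_eqF (l0 k)) ?implybT// powRr1 ?(ltW (l0 k))//.
  rewrite (lambdaE halpha2 hj) -exprVn.
  rewrite (_ : C * _ = C * lambda k `^ (nu + 1 / 2) * (normc (w.1 k) ^+ 2 +
    (gamma k)^-1 ^+ 2 * normc (w.2 k) ^+ 2)); last by rewrite (lambdaE halpha2 hj); ring.
  by apply: ler_wpM2r (HC k); rewrite addr_ge0 ?sqr_ge0// mulr_ge0 ?sqr_ge0.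
rewrite lee_wpmul2l ?lee_fin//; apply: leeD; exact: sum_le_nneseries.
Qed.

End state_estimates.

(** * The admissibility estimate *)

Theorem lemma8 (R : realType) (T alpha beta mu : R) (j : nat -> R)
    (hT : 0 < T) (halpha0 : 0 <= alpha) (halpha2 : alpha < 2)
    (hDelta : 0 <= Delta alpha beta mu)
    (hj : bessel_zeros (nu alpha beta mu) j) :
  exists2 C_T : R, 0 < C_T &
    forall w : state R, X1 alpha beta mu j w ->
      (\int[lebesgue_measure]_(t in `[0%R, T])
         (normc (obs alpha beta mu j (T_group alpha j t w)) ^+ 2)%:E
       <= C_T%:E * sqnormX alpha beta mu j w)%E.
Proof.
have [C C0 HC] := weight_le halpha2 hj.
have [D D0 HD] := ingham_series (kappa_gt0 halpha2) hT (gamma_gap halpha2 hj).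
set theta := obs_factor alpha beta mu.
(* the summand 1 makes the constant positive for every theta *)
exists (theta ^+ 2 * (2 * D * C) + 1).
  by rewrite ltr_wpDl// mulr_ge0 ?sqr_ge0// mulr_ge0 ?mulr_ge0 ?ltW.
move=> w Xw; set S := sqnormX _ _ _ _ _.
have S0 : (0 <= S)%E.
  by apply: adde_ge0; apply: nneseries_ge0 => k _ _;
    rewrite lee_fin mulr_ge0 ?powR_ge0 ?sqr_ge0.
have CT0 : 0 < theta ^+ 2 * (2 * D * C) + 1.
  by rewrite ltr_wpDl// mulr_ge0 ?sqr_ge0// mulr_ge0 ?mulr_ge0 ?ltW.
have [Soo|Sfin] := eqVneq S +oo%E.
  by rewrite Soo gt0_muley ?leey// lte_fin.
have {}Sfin : S \is a fin_num by rewrite ge0_fin_numE// ltey.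
pose wt k := weight alpha beta mu j k.
pose X (r : R[i] -> R) k := wt k * r (w.1 k).
pose Y (r : R[i] -> R) k := wt k * ((gamma alpha j k)^-1 * r (w.2 k)).
pose M k := wt k * (normc (w.1 k) + (gamma alpha j k)^-1 * normc (w.2 k)).
have cM : cvgn (series M) by exact: X1_majorant_cvg.
have wt0 k : 0 <= wt k by exact: weight_ge0.
have gV k : 0 <= (gamma alpha j k)^-1 by rewrite invr_ge0 ltW// (gamma_gt0 halpha2 hj).
pose H r := trig_series (gamma alpha j) (X r) (Y r).
have XYM r : (forall z, `|r z| <= normc z) -> forall k, `|X r k| + `|Y r k| <= M k.
  move=> rn k; rewrite /X /Y /M normrM [`|wt k * (_ * _)|]normrM [`|_^-1 * _|]normrM.
  rewrite (ger0_norm (wt0 k)) (ger0_norm (gV k)) -mulrDr ler_wpM2l// lerD//.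
  by rewrite ler_wpM2l.
have IH r : (forall z, `|r z| <= normc z) ->
    (\int[lebesgue_measure]_(t in `[0%R, T]) (H r t ^+ 2)%:E <=
      (D * (C * fine S))%:E)%E.
  move=> rn; apply: HD (XYM r rn) cM _ => n.
  rewrite -lee_fin [X in (_ <= X)%E]EFinM fineK//.
  apply: le_trans (sum_weight_le halpha2 hj _ n (ltW C0) HC).
  rewrite lee_fin; apply: ler_sum => k _.
  have rn2 z : r z ^+ 2 <= normc z ^+ 2.
    by rewrite -(real_normK (num_real (r z))) ler_pXn2r ?nnegrE ?normc_ge0.
  rewrite /X /Y !exprMn -mulrDr ler_wpM2l ?sqr_ge0// lerD//.
  by rewrite ler_wpM2l ?sqr_ge0.
have cH r : (forall z, `|r z| <= normc z) -> continuous (H r).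
  by move=> rn; exact: trig_series_continuous (XYM r rn) cM.
have mH r : (forall z, `|r z| <= normc z) ->
    measurable_fun (`[0, T] : set R) (fun t => (H r t ^+ 2)%:E).
  move=> rn; apply/measurable_EFinP; apply: measurable_funTS.
  apply: continuous_measurable_fun => t.
  by apply: cvgM; exact: cH rn t.
have HRe := @normRe_le R; have HIm := @normIm_le R.
have E t : normc (obs alpha beta mu j (T_group alpha j t w)) ^+ 2 =
    theta ^+ 2 * (H (@complex.Re R) t ^+ 2 + H (@complex.Im R) t ^+ 2).
  rewrite (obsE halpha2 hj (fun k => T_group_majorized halpha2 hj t w k) cM).
  rewrite -/theta; congr (_ * (_ ^+ 2 + _ ^+ 2)); rewrite /H /trig_series.
    congr (limn (series _)); apply/funext => k; rewrite /X /Y /=.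
    case: (w.1 k) (w.2 k) => a1 a2 [c1 c2] /=; rewrite /wt; ring.
  congr (limn (series _)); apply/funext => k; rewrite /X /Y /=.
  case: (w.1 k) (w.2 k) => a1 a2 [c1 c2] /=; rewrite /wt; ring.
under eq_integral do rewrite E EFinM EFinD.
rewrite ge0_integralZl_EFin ?sqr_ge0//; last 2 first.
- by move=> t _; rewrite adde_ge0// lee_fin sqr_ge0.
- by apply: emeasurable_funD; exact: mH.
rewrite ge0_integralD//; last 4 first.
- by move=> t _; rewrite lee_fin sqr_ge0.
- exact: mH.
- by move=> t _; rewrite lee_fin sqr_ge0.
- exact: mH.
apply: (@le_trans _ _ ((theta ^+ 2)%:E *
  ((D * (C * fine S))%:E + (D * (C * fine S))%:E))%E).
  by rewrite lee_wpmul2l ?lee_fin ?sqr_ge0// leeD//; exact: IH.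
rewrite -[S in leRHS]fineK// -EFinD -!EFinM lee_fin mulrDl mul1r.
rewrite ler_wpDr ?fine_ge0//.
by rewrite le_eqVlt; apply/orP; left; apply/eqP; ring.
Qed.
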